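(* Let $\Gamma$ be an arithmetic subgroup of $G_{\mathbb R}$ and let $\Sigma_{\mathrm{tor}}=\bigcup_{Q(S,S)=0}\Sigma(S)$ be a $\Gamma$-admissible family of polyhedral decompositions. Let $$\Sigma_{\mathrm{ev}}=\bigcup_{Q(S,S)=0,\ \dim S\le h^{0,-1}}\Sigma(S)\subset\Sigma_{\mathrm{tor}}.$$ Then the map $p^{\mathrm{ev}}:\Gamma\backslash D_{\Sigma_{\mathrm{ev}}}\to\Gamma\backslash\mathscr H_{\Sigma_{\mathrm{ev}}}$ is surjective.
   Context: Let $H_{\mathbb Z}$ be a free $\mathbb Z$-module of rank $2n$ with the alternating form $Q$ given in some basis by $\begin{pmatrix}0&I\\-I&0\end{pmatrix}$; $H_A=H_{\mathbb Z}\otimes A$, $G_A=\mathrm{Aut}(H_A,Q)\cong Sp(n,A)$, $\mathfrak g=\mathrm{Lie}(G_{\mathbb R})$. Let $\{h^{p,-p-1}\}_p$ be Hodge numbers of weight $-1$ ($h^{p,-p-1}=h^{-p-1,p}\ge 0$, $\sum_p h^{p,-p-1}=2n$). Let $D$ be the period domain of Hodge structures $F$ of weight $-1$ on $H_{\mathbb Z}$ polarized by $Q$ with these Hodge numbers (so $Q(F^p,F^{-p})=0$ and $i^{p-q}Q(v,\bar v)>0$ for $0\ne v\in H^{p,q}$), and let $\check D$ be its compact dual (flags of the same dimensions with $Q(F^p,F^{-p})=0$). Let $\mathscr H$ be the Siegel space of degree $n$, regarded as the period domain with $h^{0,-1}=h^{-1,0}=n$. All cones are finitely generated convex rational polyhedral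 cones. A nilpotent cone is $\sigma=\sum_{j=1}^{\ell}\mathbb R_{\ge0}N_j$ with mutually commuting nilpotent $N_j\in\mathfrak g_{\mathbb Q}$; $\sigma^\circ$ is its relative interior, $\sigma_{\mathbb C}$ its complex span. For $F\in\check D$, $(\sigma,\exp(\sigma_{\mathbb C})F)$ is a nilpotent orbit (a $\sigma$-nilpotent orbit) if $\exp(\sum_j i x_jN_j)F\in D$ for all $x_j\gg0$ and $NF^p\subset F^{p-1}$ for all $p$ and $N\in\sigma$. Then all $N\in\sigma^\circ$ have the same monodromy weight filtration $W(\sigma)$, centered at weight $-1$, and $(W(\sigma),F)$ is a mixed Hodge structure with Deligne decomposition $H_{\mathbb C}=\bigoplus I^{p,q}$, $W_k=\sum_{p+q\le k}I^{p,q}$, $F^\ell=\sum_{p\ge\ell}I^{p,q}$. The orbit is even-type if $N^2=0$ for all $N\in\sigma$ and $I^{p,-p}=0$ for all odd $p$. A cone $\sigma$ is even-type if it generates at least one nilpotent orbit (for $D$) and all $\sigma$-nilpotent orbits are even-type. $\mathbf B(\sigma)$ (resp. $\mathbf B_{\mathrm{tor}}(\sigma)$) is the set of $\sigma$-nilpotent orbits for $D$ (resp. for $\mathscr H$). For a fan $\Sigma$ of nilpotent cones, $D_\Sigma=\bigsqcup_{\sigma\in\Sigma}\mathbf B(\sigma)$ and $\mathscr H_\Sigma=\bigsqcup_{\sigma\in\Sigma}\mathbf B_{\mathrm{tor}}(\sigma)$; if $\mathrm{Ad}(\gamma)\Sigma=\Sigma$ for $\gamma\in\Gamma$, then $\Gamma$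 acts by $\gamma(\sigma,Z)=(\mathrm{Ad}(\gamma)\sigma,\gamma Z)$. For even-type $\sigma$, $p^{\mathrm{ev}}:\mathbf B(\sigma)\to\mathbf B_{\mathrm{tor}}(\sigma)$ is $(\sigma,\exp(\sigma_{\mathbb C})F)\mapsto(\sigma,\exp(\sigma_{\mathbb C})\tilde F)$ where $\tilde F^{-1}=H_{\mathbb C}$, $\tilde F^0=\bigl(\bigoplus_{p\text{ even}}I^{p,-p-1}\bigr)\oplus\bigl(\bigoplus_pI^{p,-p}\bigr)$, $\tilde F^1=0$. (A cone of $\Sigma_{\mathrm{tor}}$ is even-type as soon as it generates a nilpotent orbit for $D$.) These maps are $\Gamma$-equivariant and together define $p^{\mathrm{ev}}$ on $\Gamma\backslash D_\Sigma$. In what follows $S$ runs over isotropic subspaces of $H_{\mathbb R}$ (with respect to $Q$) defined over $\mathbb Q$. Put $\eta(S)=\{N\in\mathfrak g:\operatorname{Im}N\subset S\}$ and $\eta^+(S)=\{N\in\eta(S):\phi_N>0\text{ on }H_{\mathbb R}/S^\perp\}$, where $\phi_N(v,w)=Q(v,Nw)$; $\mathrm{Cl}$ denotes closure. Let $\Gamma(S)=\{\gamma\in\Gamma:\gamma S=S\}$, acting by $\mathrm{Ad}$. A fan $\Sigma(S)$ of cones in $\mathrm{Cl}(\eta^+(S))$ is a $\Gamma(S)$-admissible polyhedral decomposition of $\eta^+(S)$ if: it is stable under $\Gamma(S)$; it has finitely many $\Gamma(S)$-orbits of cones; and $\eta^+(S)=\bigcup_{\sigma\in\Sigma(S)}(\sigma\cap\eta^+(S))$.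 A union $\bigcup_{Q(S,S)=0}\Sigma(S)$ of $\Gamma(S)$-admissible polyhedral decompositions is a $\Gamma$-admissible family if $\gamma\Sigma(S)=\Sigma(\gamma S)$ for $\gamma\in\Gamma$, and whenever $S'\subset S$, $\Sigma(S')$ is the restriction of $\Sigma(S)$ to $\mathrm{Cl}(\eta^+(S'))$. *)

(* Defs.v *)
From HB Require Import structures.
From mathcomp Require Import all_boot all_order all_algebra finmap.
From mathcomp Require Import complex.
From mathcomp Require Import all_classical all_reals topology normedtype.

Set Implicit Arguments.
Unset Strict Implicit.
Unset Printing Implicit Defensive.

Import Order.TTheory GRing.Theory Num.Theory.
Import numFieldTopology.Exports numFieldNormedType.Exports.

Local Open Scope classical_set_scope.
Local Open Scope ring_scope.

(* H_A is the space 'cV[A]_(n + n) of column vectors, on which matrices act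
   on the left. *)

Definition sympJ (A : pzRingType) (n : nat) : 'M[A]_(n + n) :=
  block_mx 0 1%:M (- 1%:M) 0.

Definition sympQ (A : pzRingType) (n : nat) (v w : 'cV[A]_(n + n)) : A :=
  (v^T *m sympJ A n *m w) 0 0.

Definition Sp (A : pzRingType) (n : nat) : set 'M[A]_(n + n) :=
  [set g | g^T *m sympJ A n *m g = sympJ A n].

Definition sp_lie (A : pzRingType) (n : nat) : set 'M[A]_(n + n) :=
  [set N | N^T *m sympJ A n + sympJ A n *m N = 0].

Definition mx_image (K : fieldType) (m : nat) (g : 'M[K]_m)
    (U : {vspace 'cV[K]_m}) : {vspace 'cV[K]_m} :=
  (linfun (mulmx g : 'cV[K]_m -> 'cV[K]_m) @: U)%VS.

(* The sum of a possibly infinite family of subspaces, i.e. its least upper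
   bound, which exists because the ambient space has finite dimension. *)
Definition vsum (K : fieldType) (V : vectType K) (I : Type) (P : set I)
    (U : I -> {vspace V}) : {vspace V} :=
  xget 0%VS [set S : {vspace V} |
    (forall i, P i -> (U i <= S)%VS) /\
    (forall T : {vspace V}, (forall i, P i -> (U i <= T)%VS) -> (S <= T)%VS)].

Definition ratR (R : realType) (m k : nat) (M : 'M[rat]_(m, k)) : 'M[R]_(m, k) :=
  map_mx ratr M.

Definition toC (R : realType) (m k : nat) (M : 'M[R]_(m, k)) : 'M[R[i]]_(m, k) :=
  map_mx (real_complex R) M.

Definition conjv (R : realType) (m : nat) (v : 'cV[R[i]]_m) : 'cV[R[i]]_m :=
  map_mx Num.conj v.

Definition conjvs (R : realType) (m : nat) (U : {vspace 'cV[R[i]]_m}) :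
    {vspace 'cV[R[i]]_m} :=
  <<[seq conjv v | v <- vbasis U]>>%VS.

(* The exponential of a nilpotent matrix; the terms with k >= m vanish. *)
Definition expmx (K : fieldType) (m : nat) (N : 'M[K]_m) : 'M[K]_m :=
  \sum_(k < m) (k`!%:R)^-1 *: N ^+ k.

Section Filtrations.
Variables (R : realType) (n : nat).
Local Notation C := R[i].

(* F p is F^p for a decreasing filtration, W k is W_k for an increasing one. *)
Definition filtration : Type := int -> {vspace 'cV[C]_(n + n)}.

Definition filt_act (g : 'M[C]_(n + n)) (F : filtration) : filtration :=
  fun p => mx_image g (F p).

(* Hodge numbers of weight -1: h p stands for h^{p,-p-1}. *)
Definition hodge_numbers (h : {fsfun int -> nat with 0%N}) : Prop :=
  (forall p : int, h p = h (- p - 1)) /\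
  (\sum_(p <- finsupp h) h p)%N = (n + n)%N.

Definition siegel_numbers : {fsfun int -> nat with 0%N} :=
  [fsfun p in [fset 0; - 1]%fset => n].

Definition compact_dual (h : {fsfun int -> nat with 0%N}) : set filtration :=
  [set F | [/\ forall p q : int, p <= q -> (F q <= F p)%VS,
    forall p : int, \dim (F p) = (\sum_(r <- finsupp h | (p <= r)%R) h r)%N &
    forall (p : int) v w, v \in F p -> w \in F (- p) -> sympQ v w = 0]].

Definition hodge_structure (F : filtration) : Prop :=
  forall p : int, (F p + conjvs (F (- p)))%VS = fullv /\
                  (F p :&: conjvs (F (- p)))%VS = 0%VS.

(* For q = - p - 1 this is H^{p,q}. *)
Definition hodge_component (F : filtration) (p q : int) :
    {vspace 'cV[C]_(n + n)} :=
  (F p :&: conjvs (F q))%VS.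

Definition period_domain (h : {fsfun int -> nat with 0%N}) : set filtration :=
  [set F | [/\ compact_dual h F, hodge_structure F &
    forall p q : int, p + q = - 1 -> forall v,
      v \in hodge_component F p q -> v != 0 ->
      0 < 'i ^ (p - q) * sympQ v (conjv v)]].

(* W is the monodromy weight filtration of N centered at c: besides
   N W_k <= W_(k-2), the power N^k induces an isomorphism from
   W_(c+k) / W_(c+k-1) onto W_(c-k) / W_(c-k-1). *)
Definition monodromy_weight (N : 'M[C]_(n + n)) (c : int) (W : filtration) :
    Prop :=
  [/\ forall k l : int, k <= l -> (W k <= W l)%VS,
      (exists a : int, W a = 0%VS) /\ (exists b : int, W b = fullv),
      forall k : int, (mx_image N (W k) <= W (k - 2))%VS &
      forall k : nat,
        (forall v, v \in W (c + k%:Z) -> N ^+ k *m v \in W (c - k%:Z - 1) ->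
           v \in W (c + k%:Z - 1)) /\
        (W (c - k%:Z)%R <=
           mx_image (N ^+ k) (W (c + k%:Z)%R) + W (c - k%:Z - 1)%R)%VS].

(* Deligne's formula for the bigrading of a mixed Hodge structure (W, F):
   I^{p,q} is the intersection of F^p, W_(p+q) and
   (conj F^q :&: W_(p+q)) + \sum_(j >= 1) (conj F^(q-j) :&: W_(p+q-j-1)). *)
Definition deligneI (W F : filtration) (p q : int) : {vspace 'cV[C]_(n + n)} :=
  (F p :&: W (p + q)%R :&:
    ((conjvs (F q) :&: W (p + q)%R) +
     vsum [set j : nat | (0 < j)%N]
       (fun j => conjvs (F (q - j%:Z)%R) :&: W (p + q - j%:Z - 1)%R)))%VS.

Definition even_flag (W F : filtration) : filtration :=
  fun r : int =>
    if r <= - 1 then fullv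
    else if r == 0 then
      (vsum [set p : int | (2 %| p)%Z] (fun p => deligneI W F p (- p - 1)) +
       vsum [set: int] (fun p => deligneI W F p (- p)))%VS
    else 0%VS.

End Filtrations.

Section Cones.
Variables (R : realType) (n : nat).
Local Notation C := R[i].
Local Notation cone := (set 'M[R]_(n + n)).

Definition generated_cone (l : nat) (N : 'I_l -> 'M[rat]_(n + n)) : cone :=
  [set M | exists2 x : 'I_l -> R, (forall j, 0 <= x j) &
             M = \sum_j x j *: ratR R (N j)].

(* N generates a nilpotent cone. *)
Definition nilpotent_generators (l : nat) (N : 'I_l -> 'M[rat]_(n + n)) : Prop :=
  [/\ forall j, sp_lie (N j),
      forall j k, N j *m N k = N k *m N j &
      forall j, exists e : nat, N j ^+ e = 0].

Definition real_span (s : cone) : set 'M[R]_(n + n) :=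
  [set M | exists (l : nat) (c : 'I_l -> R) (N : 'I_l -> 'M[R]_(n + n)),
     (forall j, s (N j)) /\ M = \sum_j c j *: N j].

Definition complex_span (s : cone) : set 'M[C]_(n + n) :=
  [set M | exists (l : nat) (c : 'I_l -> C) (N : 'I_l -> 'M[R]_(n + n)),
     (forall j, s (N j)) /\ M = \sum_j c j *: toC (N j)].

(* The affine hull of a nonempty cone is its linear span. *)
Definition relint (s : cone) : cone :=
  [set N | s N /\ \forall M \near N, real_span s M -> s M].

Definition exp_orbit (s : cone) (F : filtration R n) : set (filtration R n) :=
  [set filt_act (expmx M) F | M in complex_span s].

Definition nilpotent_orbit (h : {fsfun int -> nat with 0%N}) (s : cone)
    (F : filtration R n) : Prop :=
  [/\ compact_dual h F,
      (exists (l : nat) (N : 'I_l -> 'M[rat]_(n + n)),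
        [/\ nilpotent_generators N, s = generated_cone N &
        exists c : R, forall x : 'I_l -> R, (forall j, c < x j) ->
          period_domain h
            (filt_act (expmx ('i *: toC (\sum_j x j *: ratR R (N j)))) F)]) &
      forall N, s N -> forall p : int,
        (mx_image (toC N) (F p) <= F (p - 1))%VS].

(* A point of the disjoint union of the B(s) is a pair (s, Z). *)
Definition orbit_point : Type := (cone * set (filtration R n))%type.

Definition Bset (h : {fsfun int -> nat with 0%N}) (s : cone) :
    set (set (filtration R n)) :=
  [set Z | exists2 F, nilpotent_orbit h s F & Z = exp_orbit s F].

Definition extended_domain (h : {fsfun int -> nat with 0%N}) (Sigma : set cone) :
    set orbit_point :=
  [set x | Sigma x.1 /\ Bset h x.1 x.2].

Definition Adjoint (g : 'M[R]_(n + n)) (s : cone) : cone :=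
  [set g *m N *m invmx g | N in s].

Definition point_act (g : 'M[R]_(n + n)) (x : orbit_point) : orbit_point :=
  (Adjoint g x.1, [set filt_act (toC g) F | F in x.2]).

Definition orbit_of (Gamma : set 'M[R]_(n + n)) (x : orbit_point) :
    set orbit_point :=
  [set point_act g x | g in Gamma].

Definition quotient (Gamma : set 'M[R]_(n + n)) (X : set orbit_point) :
    set (set orbit_point) :=
  [set orbit_of Gamma x | x in X].

(* W(s): the common monodromy weight filtration, centered at -1, of the
   elements of the relative interior of s. *)
Definition cone_weight (s : cone) : filtration R n :=
  xget (fun=> 0%VS)
    [set W | forall N, relint s N -> monodromy_weight (toC N) (- 1) W].

(* For Z = exp(s_C)F all the sets in the union coincide.  The map is meant for
   even-type s; the formula makes sense for every s, so it is used as a total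
   function. *)
Definition pev (x : orbit_point) : orbit_point :=
  (x.1, \bigcup_(F in x.2) exp_orbit x.1 (even_flag (cone_weight x.1) F)).

(* The map induced by pev on Gamma-orbits; pev being equivariant, the image of
   an orbit is an orbit. *)
Definition pev_quotient (O : set orbit_point) : set orbit_point := pev @` O.

End Cones.

Section Decompositions.
Variables (R : realType) (n : nat).
Local Notation cone := (set 'M[R]_(n + n)).
Local Notation subspace := {vspace 'cV[R]_(n + n)}.
Implicit Types (S : subspace) (Gamma : set 'M[R]_(n + n)) (s t : cone).

Definition rational_cone s : Prop :=
  exists (l : nat) (N : 'I_l -> 'M[rat]_(n + n)), s = generated_cone N.

Definition face t s : Prop :=
  exists2 f : {scalar 'M[R]_(n + n)}, (forall N, s N -> 0 <= f N) &
    t = [set N | s N /\ f N = 0].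

Definition is_fan (Sigma : set cone) : Prop :=
  [/\ forall s, Sigma s ->
        rational_cone s /\ (forall N, s N -> s (- N) -> N = 0),
      forall s t, Sigma s -> face t s -> Sigma t &
      forall s t, Sigma s -> Sigma t ->
        face (s `&` t) s /\ face (s `&` t) t].

Definition isotropic S : Prop :=
  forall v w, v \in S -> w \in S -> sympQ v w = 0.

Definition defined_over_Q S : Prop :=
  exists b : seq 'cV[rat]_(n + n), S = <<[seq ratR R v | v <- b]>>%VS.

Definition rational_isotropic S : Prop := isotropic S /\ defined_over_Q S.

Definition perp S : set 'cV[R]_(n + n) :=
  [set v | forall w, w \in S -> sympQ v w = 0].

Definition eta S : cone :=
  [set N | sp_lie N /\ forall v : 'cV[R]_(n + n), N *m v \in S].

(* phi_N descends to H_R / S^perp for N in eta S. *)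
Definition eta_plus S : cone :=
  [set N | eta S N /\
     forall v : 'cV[R]_(n + n), ~ perp S v -> 0 < sympQ v (N *m v)].

Definition integral_Sp : set 'M[R]_(n + n) :=
  [set g | Sp g /\ exists A : 'M[int]_(n + n), g = map_mx intr A].

Definition subgroup_Sp Gamma : Prop :=
  [/\ Gamma `<=` @Sp R n, Gamma 1%:M,
      forall g g', Gamma g -> Gamma g' -> Gamma (g *m g') &
      forall g, Gamma g -> Gamma (invmx g)].

(* For subgroups B of A: A is covered by finitely many left cosets of B. *)
Definition finite_index (A B : set 'M[R]_(n + n)) : Prop :=
  exists r : seq 'M[R]_(n + n), forall g, A g ->
    exists2 a, a \in r & exists2 b, B b & g = a *m b.

Definition arithmetic Gamma : Prop :=
  [/\ subgroup_Sp Gamma,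
      finite_index Gamma (Gamma `&` integral_Sp) &
      finite_index integral_Sp (Gamma `&` integral_Sp)].

Definition stabilizer Gamma S : set 'M[R]_(n + n) :=
  [set g | Gamma g /\ mx_image g S = S].

Definition admissible_decomposition Gamma S (Sigma : set cone) : Prop :=
  [/\ is_fan Sigma /\ (forall s, Sigma s -> s `<=` closure (eta_plus S)),
      forall g s, stabilizer Gamma S g -> Sigma s -> Sigma (Adjoint g s),
      finite_set [set [set Adjoint g s | g in stabilizer Gamma S] | s in Sigma] &
      eta_plus S = \bigcup_(s in Sigma) (s `&` eta_plus S)].

(* Only the values of Sigma at rational isotropic subspaces matter. *)
Definition admissible_family Gamma (Sigma : subspace -> set cone) : Prop :=
  [/\ forall S, rational_isotropic S ->
        admissible_decomposition Gamma S (Sigma S),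
      forall g S, Gamma g -> rational_isotropic S ->
        [set Adjoint g s | s in Sigma S] = Sigma (mx_image g S) &
      forall S S', rational_isotropic S -> rational_isotropic S' ->
        (S' <= S)%VS ->
        Sigma S' = [set s | Sigma S s /\ s `<=` closure (eta_plus S')]].

Definition Sigma_ev (h : {fsfun int -> nat with 0%N})
    (Sigma : subspace -> set cone) : set cone :=
  [set s | exists S, [/\ rational_isotropic S, (\dim S <= h 0)%N & Sigma S s]].

End Decompositions.

(* Main.v *)
Require Import Defs.
From HB Require Import structures.
From mathcomp Require Import all_boot all_order all_algebra finmap.
From mathcomp Require Import complex.
From mathcomp Require Import all_classical all_reals topology normedtype.
From mathcomp Require Import zify ring lra.

(** Let [s] be a cone of [Sigma S] with [dim S <= h^{0,-1}].  Its elements are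
    positive semidefinite with image in the isotropic space [S], so products of
    two of them vanish, exponentials are [1 + M], and the monodromy weight
    filtration is [0 <= im N <= ker N <= H] for every interior [N].

    Let [L = F^0] for a Siegel nilpotent orbit of [s].  On [L] meet [ker N] the
    form [i Q(v, conj v)] is positive definite; choose an orthogonal basis [e]
    of it, and a basis [b] of its orthogonal in [L] which is orthogonal for
    [Q(v, N (conj w))].  Then [e, b, conj e, N (conj b)] is a basis of [H_C] in
    which every vector pairs nontrivially with exactly one other.  Keep [b] in
    degree 0 and [N (conj b)] in degree -1, give the vectors [e] arbitrary even
    degrees [d] and their conjugates the odd degrees [-1 - d].  There are
    [rank N <= dim S <= h^{0,-1}] vectors [b], and the even Hodge numbers add up
    to [n], so the degrees can be distributed according to [h].  The flag by
    degree generates a nilpotent orbit for [h], because [exp(i N_x)] maps the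
    span of [e] and [b] to a positive definite Lagrangian which has an
    orthogonal basis extending [e].  The even-degree part of the [I^{p,-p-1}]
    is spanned by [e] and [I^{0,0}] by [b], so [pev] recovers [L]. *)

Set Implicit Arguments.
Unset Strict Implicit.
Unset Printing Implicit Defensive.

Import Order.TTheory GRing.Theory Num.Theory.
Import numFieldTopology.Exports numFieldNormedType.Exports.

Local Open Scope classical_set_scope.
Local Open Scope ring_scope.

(** * The symplectic form *)

Section SymplecticForm.
Variables (K : fieldType) (n : nat).
Implicit Types (v w x : 'cV[K]_(n + n)) (M g : 'M[K]_(n + n)).

Lemma sympQDl v w x : sympQ (v + w) x = sympQ v x + sympQ w x.
Proof. by rewrite /sympQ linearD /= !mulmxDl mxE. Qed.

Lemma sympQDr v w x : sympQ x (v + w) = sympQ x v + sympQ x w.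
Proof. by rewrite /sympQ mulmxDr mxE. Qed.

Lemma sympQZl a v w : sympQ (a *: v) w = a * sympQ v w.
Proof. by rewrite /sympQ linearZ /= -!scalemxAl mxE. Qed.

Lemma sympQZr a v w : sympQ v (a *: w) = a * sympQ v w.
Proof. by rewrite /sympQ -scalemxAr mxE. Qed.

Lemma sympQ0l v : sympQ 0 v = 0.
Proof. by rewrite -(scale0r 0) sympQZl mul0r. Qed.

Lemma sympQ0r v : sympQ v 0 = 0.
Proof. by rewrite -(scale0r 0) sympQZr mul0r. Qed.

Lemma sympQNl v w : sympQ (- v) w = - sympQ v w.
Proof. by rewrite -scaleN1r sympQZl mulN1r. Qed.

Lemma sympQ_suml (I : Type) (r : seq I) (P : pred I) F w :
  sympQ (\sum_(i <- r | P i) F i) w = \sum_(i <- r | P i) sympQ (F i) w.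
Proof.
by apply: (big_morph (fun v => sympQ v w)) => [x y|];
   rewrite ?sympQDl ?sympQ0l.
Qed.

Lemma sympQ_sumr (I : Type) (r : seq I) (P : pred I) F w :
  sympQ w (\sum_(i <- r | P i) F i) = \sum_(i <- r | P i) sympQ w (F i).
Proof.
by apply: (big_morph (sympQ w)) => [x y|]; rewrite ?sympQDr ?sympQ0r.
Qed.

Lemma sympJ_tr : (sympJ K n)^T = - sympJ K n.
Proof.
by rewrite /sympJ tr_block_mx opp_block_mx !trmx0 linearN /= trmx1 opprK !oppr0.
Qed.

Lemma sympJ_sqr : sympJ K n *m sympJ K n = - 1%:M.
Proof.
rewrite /sympJ mulmx_block !mulmx0 !mul0mx !mulmx1 !mulmxN !mulmx1 !addr0 !add0r.
by rewrite scalar_mx_block opp_block_mx !oppr0.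
Qed.

Lemma sympQ_antisym v w : sympQ w v = - sympQ v w.
Proof.
have -> : sympQ w v = (w^T *m sympJ K n *m v)^T 0 0 by rewrite [RHS]mxE.
by rewrite !trmx_mul trmxK sympJ_tr mulNmx mulmxN mulmxA mxE.
Qed.

Lemma sympQ_nondeg v : (forall w, sympQ w v = 0) -> v = 0.
Proof.
move=> Qv; suff: sympJ K n *m v = 0.
  by move/(congr1 (mulmx (sympJ K n))); rewrite mulmxA sympJ_sqr mulNmx mul1mx
    mulmx0 => /eqP; rewrite oppr_eq0 => /eqP.
apply/matrixP => i j; rewrite (ord1 j) [RHS]mxE.
by rewrite -[RHS](Qv (delta_mx i 0)) /sympQ trmx_delta -mulmxA -rowE [RHS]mxE.
Qed.

Lemma sp_lieE M : sp_lie M -> M^T *m sympJ K n = - (sympJ K n *m M).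
Proof. by move=> h; apply/eqP; rewrite -subr_eq0 opprK; apply/eqP. Qed.

Lemma sympQ_lie M v w : sp_lie M -> sympQ (M *m v) w = - sympQ v (M *m w).
Proof.
move=> /sp_lieE hM.
by rewrite /sympQ trmx_mul -(mulmxA v^T) hM mulmxN mulNmx mxE !mulmxA.
Qed.

Lemma sp_lieP M : (forall v w, sympQ (M *m v) w = - sympQ v (M *m w)) ->
  sp_lie M.
Proof.
move=> hM; apply/matrixP => i j; rewrite mxE [RHS]mxE.
have := hM (delta_mx i 0) (delta_mx j 0).
have E A : ((delta_mx i 0 : 'cV[K]_(n+n))^T *m A *m (delta_mx j 0 : 'cV_(n+n))) 0 0 = A i j.
  by rewrite trmx_delta -rowE -colE !mxE.
rewrite /sympQ trmx_mul mulmxA -(mulmxA _ M^T) E -(mulmxA _ (sympJ K n)).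
rewrite E => ->; exact: addNr.
Qed.

Lemma sp_lie_sum (I : Type) (r : seq I) (c : I -> K) (N : I -> 'M[K]_(n + n)) :
  (forall i, sp_lie (N i)) -> sp_lie (\sum_(i <- r) c i *: N i).
Proof.
move=> hN; apply: sp_lieP => v w; rewrite !mulmx_suml sympQ_suml sympQ_sumr -sumrN.
by apply: eq_bigr => i _; rewrite -!scalemxAl sympQZl sympQZr sympQ_lie ?mulrN.
Qed.

Lemma sympQ_Sp g v w : Sp g -> sympQ (g *m v) (g *m w) = sympQ v w.
Proof.
move=> hg.
rewrite /sympQ trmx_mul mulmxA -(mulmxA v^T) -(mulmxA v^T).
have -> : g^T *m sympJ K n *m g = sympJ K n by [].
by [].
Qed.

Lemma Sp_unit g : Sp g -> g \in unitmx.
Proof.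
move=> hg.
have : (- sympJ K n *m g^T *m sympJ K n) *m g = 1%:M.
  rewrite -!mulmxA (mulmxA g^T) [X in _ *m X](_ : _ = sympJ K n) //.
  by rewrite mulNmx sympJ_sqr opprK.
by case/mulmx1_unit.
Qed.

(* The image of an element of the Lie algebra is the orthogonal of its kernel,
   so an inclusion of kernels is also an inclusion of images. *)
Lemma sp_lie_factor M N X : sp_lie M -> sp_lie N -> M = X *m N ->
  exists Y, M = N *m Y.
Proof.
move=> hM hN eM; pose J := sympJ K n.
have JM A : sp_lie A -> A = J *m A^T *m J.
  move=> hA; rewrite -mulmxA sp_lieE // mulmxN mulmxA sympJ_sqr.
  by rewrite mulNmx opprK mul1mx.
exists (- (J *m X^T *m J)).
rewrite (JM _ hM) [in LHS]eM trmx_mul.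
transitivity (J *m N^T *m (J *m - J) *m X^T *m J).
  by rewrite mulmxN sympJ_sqr opprK mulmx1 !mulmxA.
by rewrite mulmxA -(JM _ hN) !mulmxN !mulNmx !mulmxA.
Qed.

Lemma span_sympQ (s : seq 'cV[K]_(n + n)) v w :
  v \in <<s>>%VS -> (forall x, x \in s -> sympQ x w = 0) -> sympQ v w = 0.
Proof.
move=> /(@coord_span _ _ _ (in_tuple s)) -> h; rewrite sympQ_suml big1 // => i _.
by rewrite sympQZl h ?mulr0 // mem_nth.
Qed.

End SymplecticForm.

(** * Images of subspaces, sums of families and square-zero exponentials *)

Lemma mem_mx_image (K : fieldType) m (g : 'M[K]_m) (U : {vspace 'cV[K]_m}) v :
  reflect (exists2 w, w \in U & v = g *m w) (v \in mx_image g U).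
Proof.
apply: (iffP memv_imgP) => -[w wU ->]; exists w => //; by rewrite lfunE.
Qed.

Lemma mx_image_span (K : fieldType) m (g : 'M[K]_m) (s : seq 'cV[K]_m) :
  mx_image g <<s>>%VS = <<map (mulmx g) s>>%VS.
Proof. by rewrite /mx_image limg_span; congr span; apply: eq_map => v; rewrite lfunE. Qed.

Lemma mx_image_comp (K : fieldType) m (g g' : 'M[K]_m) (U : {vspace 'cV[K]_m}) :
  mx_image g (mx_image g' U) = mx_image (g *m g') U.
Proof.
apply/vspaceP => v; apply/mem_mx_image/mem_mx_image.
  by case=> w /mem_mx_image [x xU ->] ->; exists x; rewrite ?mulmxA.
case=> w wU ->; exists (g' *m w); last by rewrite mulmxA.
by apply/mem_mx_image; exists w.
Qed.

Lemma dim_cV (K : fieldType) n : \dim (fullv : {vspace 'cV[K]_(n + n)}) = (n + n)%N.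
Proof. by rewrite dimvf dim_matrix mulr1. Qed.

(** [vsum] is defined by choice, so a least upper bound has to be exhibited. An upper bound [S] of
    minimal dimension works: for any other upper bound [T], [S :&: T] is again one, hence equals
    [S]. *)
Lemma vsum_lub (K : fieldType) (V : vectType K) (I : Type) (P : set I)
    (U : I -> {vspace V}) :
  (forall i, P i -> (U i <= vsum P U)%VS) /\
  (forall T : {vspace V}, (forall i, P i -> (U i <= T)%VS) -> (vsum P U <= T)%VS).
Proof.
rewrite /vsum; set A := [set S | _].
suff [S AS] : exists S, A S by have := xgetPex 0%VS (ex_intro _ S AS).
pose B := [set T : {vspace V} | forall i, P i -> (U i <= T)%VS].
have Bex : exists k, `[< exists2 T, B T & \dim T = k >].
  by exists (\dim (fullv : {vspace V})); apply/asboolP; exists fullv => // i _; exact: subvf.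
case: (ex_minnP Bex) => k /asboolP [S BS dS] kmin; exists S; split=> // T BT.
have BST : B (S :&: T)%VS by move=> i Pi; rewrite subv_cap BS ?BT.
have le : (k <= \dim (S :&: T))%N by apply: kmin; apply/asboolP; exists (S :&: T)%VS.
have : (S :&: T == S)%VS.
  by rewrite eqEdim capvSl dS.
by move/eqP <-; exact: capvSr.
Qed.

Lemma vsum_ub (K : fieldType) (V : vectType K) (I : Type) (P : set I)
    (U : I -> {vspace V}) i : P i -> (U i <= vsum P U)%VS.
Proof. by have [h _] := vsum_lub P U; exact: h. Qed.

Lemma vsum_le (K : fieldType) (V : vectType K) (I : Type) (P : set I)
    (U : I -> {vspace V}) T :
  (forall i, P i -> (U i <= T)%VS) -> (vsum P U <= T)%VS.
Proof. by have [_ h] := vsum_lub P U; exact: h. Qed.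

Lemma expmx_nilp2 (K : fieldType) n (N : 'M[K]_(n + n)) :
  N *m N = 0 -> expmx N = 1%:M + N.
Proof.
(* The truncated series has as many terms as the size of the matrix. Size 0 is trivial, and size 1,
   where the linear term would be cut off, is excluded by parity. *)
have : (n + n)%N != 1%N by case: n {N} => // n; rewrite addSn addnS.
move: (n + n)%N N => [|[//|m]] N _ N2; first by apply/matrixP => -[].
rewrite /expmx !big_ord_recl big1 => [|i _] /=.
  by rewrite invr1 !scale1r expr0 expr1 addr0.
have -> : N ^+ (bump 0 (bump 0 i)) = N *m N *m N ^+ i.
  by rewrite /bump /= !add1n !exprS mulrA.
by rewrite N2 mul0mx scaler0.
Qed.

(** * Symplectic frames and their flags *)

Section Frames.
Variables (K : fieldType) (n : nat).
Implicit Types (t : bool * 'I_n -> 'cV[K]_(n + n)) (d : 'I_n -> int).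

Definition swap (k : bool * 'I_n) : bool * 'I_n := (~~ k.1, k.2).

Lemma swapK : involutive swap.
Proof. by case=> b a; rewrite /swap /= negbK. Qed.

(** A symplectic basis up to scaling: the paired values are only asked to be nonzero, so orthogonal
    bases give frames without normalization. *)
Definition frame t : Prop :=
  forall k l, (sympQ (t k) (t l) == 0) = (l != swap k).

(* Paired vectors lie in F^p / F^(p+1) for degrees p adding up to the weight
   -1; hence F^p is the orthogonal of F^(-p). *)
Definition deg d (k : bool * 'I_n) : int := if k.1 then - 1 - d k.2 else d k.2.

Lemma deg_swap d k : deg d (swap k) = - 1 - deg d k.
Proof. by case: k => -[] a; rewrite /deg //=; lia. Qed.

Definition espan t (P : pred (bool * 'I_n)) : {vspace 'cV[K]_(n + n)} :=
  <<map t (enum P)>>%VS.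

Definition tflag t d (p : int) : {vspace 'cV[K]_(n + n)} :=
  espan t [pred k | p <= deg d k].

Lemma mx_image_tflag g t d p :
  mx_image g (tflag t d p) = tflag (fun k => g *m t k) d p.
Proof. by rewrite /tflag /espan mx_image_span -map_comp. Qed.

Variable t : bool * 'I_n -> 'cV[K]_(n + n).
Hypothesis ft : frame t.

Lemma frame_eq k l : l != swap k -> sympQ (t k) (t l) = 0.
Proof. by rewrite -ft => /eqP. Qed.

Lemma frame_neq0 k : sympQ (t k) (t (swap k)) != 0.
Proof. by rewrite ft eqxx. Qed.

(** A vector in the span of the others would be orthogonal to its own partner. *)
Lemma frame_free s : uniq s -> free (map t s).
Proof.
elim: s => [|k s IHs] /=; first by rewrite nil_free.
case/andP=> ks us; rewrite free_cons IHs // andbT; apply/negP => tk.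
have := frame_neq0 k; rewrite (span_sympQ tk) ?eqxx // => _ /mapP [l ls ->].
apply: frame_eq; apply: contraNneq ks => /(congr1 swap); rewrite !swapK => ->.
by [].
Qed.

Lemma dim_espan P : \dim (espan t P) = #|P|.
Proof.
have := frame_free (enum_uniq P); rewrite /free => /eqP ->.
by rewrite size_map cardE.
Qed.

Lemma frame_full : espan t predT = fullv.
Proof.
apply/eqP; rewrite eqEdim subvf dim_espan dim_cV.
by rewrite (eq_card (B := predT)) // card_prod card_bool card_ord; lia.
Qed.

Lemma frame_nondeg v : (forall k, sympQ v (t k) = 0) -> v = 0.
Proof.
move=> Qv; apply: sympQ_nondeg => w; rewrite sympQ_antisym.
have : w \in espan t predT by rewrite frame_full memvf.
rewrite sympQ_antisym => /span_sympQ ->; rewrite ?oppr0 // => _ /mapP [k _ ->].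
by rewrite sympQ_antisym Qv oppr0.
Qed.

Lemma frame_expand v :
  v = \sum_k (sympQ v (t (swap k)) / sympQ (t k) (t (swap k))) *: t k.
Proof.
apply/eqP; rewrite -subr_eq0; apply/eqP/frame_nondeg => k.
rewrite sympQDl sympQNl sympQ_suml (bigD1 (swap k)) //= swapK big1 => [|l lk].
  rewrite addr0 sympQZl divfK ?subrr //.
  by have := frame_neq0 (swap k); rewrite swapK.
rewrite sympQZl (@frame_eq l k) ?mulr0 //.
by apply: contraNneq lk => ->; rewrite swapK.
Qed.

(** Pairing with the partner of [t k] reads off the coefficient of [t k]. Membership in a span of
    frame vectors thus becomes a list of orthogonality relations, and flags are handled in this form
    from here on. *)
Lemma mem_espan (P : pred (bool * 'I_n)) v :
  v \in espan t P <-> (forall k, ~~ P k -> sympQ v (t (swap k)) = 0).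
Proof.
split=> [vP k Pk|Qv].
  apply: (span_sympQ vP) => _ /mapP [l + ->]; rewrite mem_enum => Pl.
  apply: frame_eq; rewrite (inj_eq (can_inj swapK)).
  by apply: contraNneq Pk => ->.
rewrite (frame_expand v); apply: memv_suml => k _.
have [Pk|Pk] := boolP (P k); last by rewrite Qv // mul0r scale0r mem0v.
by apply/memvZ/memv_span/map_f; rewrite mem_enum.
Qed.

Lemma mem_tflag d p v :
  v \in tflag t d p <-> (forall k, - p <= deg d k -> sympQ v (t k) = 0).
Proof.
split=> [/mem_espan Qv k pk|Qv].
  by rewrite -(swapK k) Qv //= deg_swap; lia.
by apply/mem_espan => k /=; rewrite -ltNge => pk; rewrite Qv // deg_swap; lia.
Qed.

Lemma tflag_vec d p k : p <= deg d k -> t k \in tflag t d p.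
Proof. by move=> pk; apply/memv_span/map_f; rewrite mem_enum. Qed.

Lemma dim_tflag d p : \dim (tflag t d p) = #|[pred k | p <= deg d k]|.
Proof. exact: dim_espan. Qed.

Lemma tflag_isotropic d p v w :
  v \in tflag t d p -> w \in tflag t d (- p) -> sympQ v w = 0.
Proof.
move=> /mem_tflag Qv /span_sympQ wt; rewrite sympQ_antisym wt ?oppr0 //.
move=> _ /mapP [k + ->]; rewrite mem_enum => pk.
by rewrite sympQ_antisym Qv ?oppr0.
Qed.

Lemma tflag_subset d p q : p <= q -> (tflag t d q <= tflag t d p)%VS.
Proof.
move=> pq; apply: sub_span => _ /mapP [k + ->]; rewrite mem_enum => qk.
by apply/map_f; rewrite mem_enum; exact: le_trans qk.
Qed.

End Frames.

(** Both flags have the same dimensions, which depend only on [d], so one inclusion suffices. It is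
    tested by pairing degrees at least [p] with degrees at least [- p], whose sum is nonnegative. *)
Lemma tflag_eq (K : fieldType) n (t t' : bool * 'I_n -> 'cV[K]_(n + n)) d :
  frame t -> frame t' ->
  (forall k l, 0 <= deg d k + deg d l -> sympQ (t' k) (t l) = 0) ->
  tflag t' d = tflag t d.
Proof.
move=> ft ft' Q0; apply/funext => p; apply/eqP; rewrite eqEdim !dim_tflag // leqnn.
rewrite andbT; apply/span_subvP => _ /mapP [k + ->]; rewrite mem_enum => pk.
by apply/mem_tflag => // l pl; apply: Q0; move: pk pl; rewrite inE; lia.
Qed.

(** * Complex conjugation and the complexified form *)

Section Conjugation.
Variable R : realType.
Local Notation C := R[i].

Lemma conj_real (x : R) : Num.conj (real_complex R x) = real_complex R x.
Proof.
exact: conjc_real.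
Qed.

Variable m : nat.
Implicit Types (v w : 'cV[C]_m).

Lemma conjvK : involutive (@conjv R m).
Proof. by move=> v; apply/matrixP => i j; rewrite !mxE conjCK. Qed.

Lemma conjvD v w : conjv (v + w) = conjv v + conjv w.
Proof. exact: map_mxD. Qed.

Lemma conjvZ a v : conjv (a *: v) = Num.conj a *: conjv v.
Proof. by apply/matrixP => i j; rewrite !mxE rmorphM. Qed.

Lemma conjv0 : conjv (0 : 'cV[C]_m) = 0.
Proof. exact: map_mx0. Qed.

Lemma conjv_sum (I : Type) (r : seq I) (F : I -> 'cV[C]_m) :
  conjv (\sum_(i <- r) F i) = \sum_(i <- r) conjv (F i).
Proof. by apply: (big_morph _ conjvD conjv0). Qed.

Lemma conjv_toC (M : 'M[R]_m) v : conjv (toC M *m v) = toC M *m conjv v.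
Proof.
rewrite /conjv map_mxM; congr (_ *m _).
by apply/matrixP => i j; rewrite /toC !mxE; exact: conj_real.
Qed.

Lemma mem_conjvs (U : {vspace 'cV[C]_m}) v : (v \in conjvs U) = (conjv v \in U).
Proof.
apply/idP/idP => [/(@coord_span _ _ _ (in_tuple _)) ->|cvU].
  rewrite conjv_sum; apply: memv_suml => i _; rewrite conjvZ; apply: memvZ.
  have : (in_tuple [seq conjv w | w <- vbasis U])`_i \in [seq conjv w | w <- vbasis U].
    exact: mem_nth.
  by case/mapP => w wU ->; rewrite conjvK; exact: vbasis_mem.
rewrite -(conjvK v) (coord_vbasis cvU) conjv_sum; apply: memv_suml => i _.
rewrite conjvZ; by apply/memvZ/memv_span/map_f; rewrite mem_nth ?size_tuple.
Qed.

End Conjugation.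

Section ComplexForm.
Variables (R : realType) (n : nat).
Local Notation C := R[i].
Implicit Types (v w : 'cV[C]_(n + n)).

Lemma sympJ_toC : toC (sympJ R n) = sympJ C n.
Proof.
rewrite /toC /sympJ map_block_mx !map_mx0 map_mxN; congr block_mx.
  exact: map_mx1.
congr (- _); exact: map_mx1.
Qed.

Lemma sympQ_conj v w : sympQ (conjv v) (conjv w) = Num.conj (sympQ v w).
Proof.
rewrite /sympQ -sympJ_toC -mulmxA -conjv_toC -mulmxA /conjv map_trmx -map_mxM mxE.
by [].
Qed.

Lemma sympQ_toC (v w : 'cV[R]_(n + n)) :
  sympQ (toC v) (toC w) = real_complex R (sympQ v w).
Proof. by rewrite /sympQ -sympJ_toC /toC map_trmx -!map_mxM mxE. Qed.

Lemma toC_sum (I : Type) (r : seq I) (P : pred I) p q (F : I -> 'M[R]_(p, q)) :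
  toC (\sum_(i <- r | P i) F i) = \sum_(i <- r | P i) toC (F i).
Proof. by apply: (big_morph (@toC R p q)); [exact: map_mxD|exact: map_mx0]. Qed.

Lemma toCM p q r (A : 'M[R]_(p, q)) (B : 'M[R]_(q, r)) : toC (A *m B) = toC A *m toC B.
Proof. exact: map_mxM. Qed.

Lemma toCZ p q a (A : 'M[R]_(p, q)) : toC (a *: A) = real_complex R a *: toC A.
Proof. exact: map_mxZ. Qed.

Lemma sp_lie_toC (M : 'M[R]_(n + n)) : sp_lie M -> sp_lie (toC M).
Proof.
rewrite /sp_lie /= => hM; rewrite -sympJ_toC /toC map_trmx -!map_mxM -map_mxD.
by rewrite hM map_mx0.
Qed.

Lemma Sp_toC (g : 'M[R]_(n + n)) : Sp g -> Sp (toC g).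
Proof.
by rewrite /Sp /= => hg; rewrite -sympJ_toC /toC map_trmx -!map_mxM hg.
Qed.

Lemma cV_decomp v : exists x y : 'cV[R]_(n + n), v = toC x + 'i *: toC y.
Proof.
exists (map_mx (@complex.Re R) v), (map_mx (@complex.Im R) v).
apply/matrixP => i j; rewrite !mxE.
exact: complexE.
Qed.

End ComplexForm.

(** * Monodromy weight filtrations of square-zero matrices *)

Section MonodromyWeight.
Variables (R : realType) (n : nat).
Local Notation C := R[i].
Implicit Types (A : 'M[C]_(n + n)) (W : filtration R n).

Definition kermx_vs A : {vspace 'cV[C]_(n + n)} :=
  lker (linfun (mulmx A : 'cV[C]_(n + n) -> 'cV[C]_(n + n))).

Lemma mem_kermx_vs A v : (v \in kermx_vs A) = (A *m v == 0).
Proof. by rewrite memv_ker lfunE. Qed.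

Definition weight2 A : filtration R n := fun k =>
  if k <= - 3 then 0%VS else if k == - 2 then mx_image A fullv
  else if k == - 1 then kermx_vs A else fullv.

Lemma weight2_monodromy A : A *m A = 0 -> monodromy_weight A (- 1) (weight2 A).
Proof.
move=> A2; have w0 (k : int) : k <= - 3 -> weight2 A k = 0%VS by rewrite /weight2 => ->.
have w1 : weight2 A (- 1) = kermx_vs A by [].
have w2 : weight2 A (- 2) = mx_image A fullv by [].
have w3 (k : int) : 0 <= k -> weight2 A k = fullv.
  move=> k0; rewrite /weight2 ifF; last by lia.
  by rewrite !ifF //; lia.
have imker : (mx_image A fullv <= kermx_vs A)%VS.
  by apply/subvP => _ /mem_mx_image [w _ ->]; rewrite mem_kermx_vs mulmxA A2 mul0mx.
have cases (k : int) : [\/ k <= - 3, k = - 2, k = - 1 | 0 <= k].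
  have [?|?] := leP k (- 3); first by constructor 1.
  have [?|?] := leP 0 k; first by constructor 4.
  have [->|?] := eqVneq k (- 1); first by constructor 3.
  by constructor 2; lia.
split.
- move=> k l; case: (cases l) => [lk kl|->|->|l0 _].
  + by rewrite w0 ?sub0v //; lia.
  + case: (cases k) => [/w0 -> //|->//|->//|]; [by rewrite sub0v|lia].
  + case: (cases k) => [/w0 -> //|->//|->//|]; [by rewrite sub0v|lia].
  + by rewrite (w3 l) // subvf.
- by split; [exists (- 3); rewrite w0|exists 0; rewrite w3].
- move=> k; case: (cases k) => [k3|->|->|k0].
  + rewrite (w0 k) //; apply/subvP => _ /mem_mx_image [w + ->].
    by rewrite memv0 => /eqP ->; rewrite mulmx0 mem0v.
  + rewrite w2; apply/subvP => _ /mem_mx_image [w /(subvP imker) + ->].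
    by rewrite mem_kermx_vs => /eqP ->; rewrite mem0v.
  + rewrite w1; apply/subvP => _ /mem_mx_image [w + ->].
    by rewrite mem_kermx_vs => /eqP ->; rewrite mem0v.
  + apply: (@subv_trans _ _ (mx_image A fullv)).
      by apply: limgS; rewrite subvf.
    case: (cases (k - 2)) => [|->//|->//|k2]; [lia|by rewrite w3 // subvf].
(* From the second power on both conditions are trivial: [W (c + k - 1)] is already everything and
   [W (c - k)] is zero. *)
- case=> [|[|k]].
  + rewrite expr0 -[- 1 + 0%N%:Z]/(- 1 : int).
    split=> [v|]; first by rewrite mul1mx.
    apply: subv_trans (addvSl _ _).
    by apply/subvP => v vW; apply/mem_mx_image; exists v; rewrite ?mul1mx.
  + rewrite expr1 -[- 1 + 1%:Z - 1]/(- 1 : int) -[- 1 - 1%:Z - 1]/(- 3 : int).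
    rewrite -[- 1 + 1%:Z]/(0 : int) -[- 1 - 1%:Z]/(- 2 : int) (w3 0) // w2 w1 w0 //.
    by split=> [v _|]; rewrite ?memv0 ?mem_kermx_vs // addv0.
  + split=> [v _ _|]; first by rewrite w3 ?memvf //; lia.
    by rewrite w0 ?sub0v //; lia.
Qed.

(** Powers [A ^+ k] with [k >= 2] vanish, so the graded pieces of weight at least 1 and at most -3
    are zero. Being exhaustive and separated, [W] is everything from 0 on and zero up to -3; the
    conditions for the first power then force image and kernel in the two weights between. *)
Lemma monodromy_weight_uniq A W :
  A *m A = 0 -> monodromy_weight A (- 1) W -> W = weight2 A.
Proof.
move=> A2 [Wmono [[a Wa] [b Wb]] WA Wk].
have Ak k : A ^+ k.+2 = 0 by rewrite !exprS mulrA -[A * A]/(A *m A) A2 mul0r.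
have Wtop (k : int) : 0 <= k -> W k = fullv.
  (* Injectivity of the zero map [A ^+ j.+2] on the graded piece of weight [j + 1] kills that
     piece. *)
  have step (j : nat) : W j.+1%:Z = fullv -> W j%:Z = fullv.
    move=> Wj; apply/vspaceP => v; rewrite memvf.
    have [h _] := Wk j.+2; have := h v.
    rewrite Ak mul0mx mem0v (_ : - 1 + _ - 1 = j%:Z); last by lia.
    rewrite (_ : - 1 + _ = j.+1%:Z) ?Wj; last by lia.
    by apply; rewrite ?memvf.
  have W0 : W 0 = fullv.
    have [b0|b0] := leP b 0; first by apply/eqP; rewrite eqEsubv subvf -Wb Wmono.
    have : W `|b|%N%:Z = fullv by rewrite gez0_abs ?ltW.
    by elim: `|b|%N => [//|j IH] /step.
  by move=> k0; apply/eqP; rewrite eqEsubv subvf -W0 Wmono.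
have Wbot (k : int) : k <= - 3 -> W k = 0%VS.
  (* Dually, surjectivity of a zero map kills the graded piece of weight [- 3 - j]. *)
  have step (j : nat) : W (- 4 - j%:Z) = 0%VS -> W (- 3 - j%:Z) = 0%VS.
    move=> Wj; have [_] := Wk j.+2; rewrite Ak.
    rewrite (_ : - 1 - j.+2%:Z = - 3 - j%:Z); last by lia.
    rewrite (_ : - 3 - j%:Z - 1 = - 4 - j%:Z) ?Wj ?addv0; last by lia.
    move=> h; apply/eqP; rewrite -subv0; apply: (subv_trans h).
    by apply/subvP => _ /mem_mx_image [w _ ->]; rewrite mul0mx mem0v.
  have W3 : W (- 3) = 0%VS.
    have [b0|b0] := leP (- 3) a; first by apply/eqP; rewrite -subv0 -Wa Wmono.
    have : W (- 3 - `|(- 3 - a)%R|%N%:Z) = 0%VS.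
      by rewrite (_ : _ - _ = a) //; lia.
    elim: `|(- 3 - a)%R|%N => [|j IH]; first by rewrite subr0.
    rewrite (_ : - 3 - j.+1%:Z = - 4 - j%:Z); last by lia.
    by move/step.
  by move=> k3; apply/eqP; rewrite -subv0 -W3 Wmono.
have W2 : W (- 2) = mx_image A fullv.
  apply/eqP; rewrite eqEsubv; apply/andP; split.
    have [_] := Wk 1%N; rewrite expr1 -[- 1 - 1%:Z - 1]/(- 3 : int).
    rewrite -[- 1 + 1%:Z]/(0 : int) -[- 1 - 1%:Z]/(- 2 : int) (Wtop 0) //.
    rewrite (Wbot (- 3)) // addv0.
    by [].
  by rewrite -(Wtop 0) // -[- 2 : int]/(0 - 2 : int) WA.
have W1 : W (- 1) = kermx_vs A.
  apply/eqP; rewrite eqEsubv; apply/andP; split; apply/subvP => v.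
    move=> vW; rewrite mem_kermx_vs -memv0 -(Wbot (- 1 - 2)) //.
    by apply: (subvP (WA _)); apply/mem_mx_image; exists v.
  rewrite mem_kermx_vs => /eqP Av; have [h _] := Wk 1%N; apply: (h v).
    by rewrite Wtop ?memvf.
  by rewrite expr1 Av mem0v.
apply/funext => k; rewrite /weight2.
have [k3|k3] := leP k (- 3); first exact: Wbot.
have [->|k2] := eqVneq k (- 2); first exact: W2.
have [->|k1] := eqVneq k (- 1); first exact: W1.
by apply: Wtop; lia.
Qed.

End MonodromyWeight.

(** * Positive semidefinite elements of the Lie algebra *)

Section PolarizedCones.
Variables (R : realType) (n : nat).
Implicit Types (M A B : 'M[R]_(n + n)) (v : 'cV[R]_(n + n)).

Definition psd A : Prop := sp_lie A /\ forall v, 0 <= sympQ v (A *m v).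

Lemma psd_sym A v w : psd A -> sympQ w (A *m v) = sympQ v (A *m w).
Proof. by case=> hA _; rewrite sympQ_antisym sympQ_lie // opprK. Qed.

(** The Cauchy-Schwarz argument: along the line [w + x v] the semidefinite form is affine in [x],
    hence its slope [2 Q(w, A v)] is zero for every [w]. *)
Lemma psd_kernel A v : psd A -> sympQ v (A *m v) = 0 -> A *m v = 0.
Proof.
move=> pA Av0; apply: sympQ_nondeg => w; have [hA A0] := pA.
pose c := sympQ w (A *m v); pose q := sympQ w (A *m w).
have h (x : R) : 0 <= q + x * c *+ 2.
  have := A0 (w + x *: v).
  rewrite mulmxDr -scalemxAr !(sympQDl, sympQDr, sympQZl, sympQZr) Av0 !mulr0 addr0.
  by rewrite (psd_sym w v pA) -/c -addrA -mulr2n.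
apply/eqP; apply/negPn/negP => c0; have := h (- (q + 1) / (c *+ 2)).
(* This value of [x] would make the form equal to -1. *)
have -> : - (q + 1) / (c *+ 2) * c *+ 2 = - (q + 1).
  by rewrite -mulrnAr divfK //; rewrite mulrn_eq0.
by lra.
Qed.

Lemma psd_sum (I : finType) (x : I -> R) (N : I -> 'M[R]_(n + n)) :
  (forall i, psd (N i)) -> (forall i, 0 <= x i) -> psd (\sum_i x i *: N i).
Proof.
move=> pN x0; split; first by apply: sp_lie_sum => i; case: (pN i).
move=> v; rewrite mulmx_suml sympQ_sumr sumr_ge0 // => i _.
by rewrite -scalemxAl sympQZr mulr_ge0 //; case: (pN i).
Qed.

Lemma psd_addl_kernel A B v : psd A -> psd B -> (A + B) *m v = 0 -> A *m v = 0.
Proof.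
move=> pA pB h; apply: psd_kernel => //; have := sympQ0r v.
rewrite -{1}h mulmxDl sympQDr => /eqP; rewrite paddr_eq0; first by case/andP => /eqP.
  by case: pA.
by case: pB.
Qed.

(** The columns of [cokermx A] lie in the kernel of [A], so [M] kills them; this is the criterion
    for the row space of [M] to lie in that of [A]. *)
Lemma kernel_factor (F : fieldType) m (M A : 'M[F]_m) :
  (forall v : 'cV_m, A *m v = 0 -> M *m v = 0) -> exists X, M = X *m A.
Proof.
move=> h; suff /submxP [X ->] : (M <= A)%MS by exists X.
rewrite submxE; apply/eqP/matrixP => i j.
have Acol (B : 'M_m) : B *m col j (cokermx A) = col j (B *m cokermx A).
  by rewrite !colE mulmxA.
have := h (col j (cokermx A)); rewrite !Acol mulmx_coker col0 => /(_ erefl).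
by move=> /matrixP /(_ i 0); rewrite [LHS]mxE => ->; rewrite !mxE.
Qed.

End PolarizedCones.

(** * Polarized cones *)

Section MatrixTopology.
Variables (R : realType) (m : nat).
Implicit Types (A M N : 'M[R]_m).

Lemma near_mxP N (P : set 'M[R]_m) :
  (\forall M \near N, P M) <->
  exists2 e : R, 0 < e & forall M, (forall i j, `|M i j - N i j| < e) -> P M.
Proof.
split=> [/nbhs_ballP [e /= e0 h]|[e e0 h]].
  exists e => // M MN; apply: h; split=> // i j; rewrite /ball /=.
  by rewrite distrC.
apply/nbhs_ballP; exists e => //= M [_ MN]; apply: h => i j.
by have := MN i j; rewrite /ball /= distrC.
Qed.

Lemma scalar_mxE (f : {scalar 'M[R]_m}) M :
  f M = \sum_i \sum_j M i j * f (delta_mx i j).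
Proof.
rewrite {1}(matrix_sum_delta M) linear_sum; apply: eq_bigr => i _.
by rewrite linear_sum; apply: eq_bigr => j _; rewrite linearZ.
Qed.

(** The sum [c] of the absolute values of [f] on elementary matrices is a Lipschitz constant for the
    entrywise distance. If [f N] were negative, [f] would stay negative within distance [e] of [N],
    because [e * c < - f N]. *)
Lemma closure_scalar_ge0 (A : set 'M[R]_m) (f : 'M[R]_m -> R) N : scalar f ->
  (forall M, A M -> 0 <= f M) -> closure A N -> 0 <= f N.
Proof.
move=> lf fA cN; rewrite leNgt; apply/negP => fN.
pose g : {scalar 'M[R]_m} := HB.pack f (GRing.isLinear.Build _ _ _ _ f lf).
pose c := \sum_i \sum_j `|g (delta_mx i j)|.
have c0 : 0 <= c by do 2![apply: sumr_ge0 => ? _].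
pose e := - f N / (c + 1).
have e0 : 0 < e by rewrite divr_gt0 ?oppr_gt0 // ltr_wpDl.
pose B := [set M | forall i j, `|M i j - N i j| < e].
have : nbhs N B by apply/near_mxP; exists e.
case/cN => M [/fA fM BM].
have : f M - f N <= e * c.
  have -> : f M - f N = g (M - N) by rewrite linearB.
  rewrite scalar_mxE mulr_sumr ler_sum // => i _.
  rewrite mulr_sumr ler_sum // => j _; rewrite !mxE.
  apply: le_trans (ler_norm _) _; rewrite normrM ler_wpM2r //.
  exact: ltW.
apply/negP; rewrite -ltNge; apply: (@lt_le_trans _ _ (- f N)); last by lra.
by rewrite /e mulrAC ltr_pdivrMr ?ltr_wpDl // ltr_pM2l ?oppr_gt0 // ltrDl.
Qed.

Lemma closure_scalar_eq0 (A : set 'M[R]_m) (f : 'M[R]_m -> R) N : scalar f ->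
  (forall M, A M -> f M = 0) -> closure A N -> f N = 0.
Proof.
move=> lf fA cN; apply/eqP; rewrite eq_le -oppr_ge0; apply/andP; split.
  apply: (@closure_scalar_ge0 A (fun M => - f M)) cN.
    by move=> a M M'; rewrite lf opprD mulrN.
  by move=> M /fA ->; rewrite oppr0.
by apply: closure_scalar_ge0 cN => // M /fA ->.
Qed.

End MatrixTopology.

Section PolarizedCone.
Variables (R : realType) (n : nat).
Local Notation C := R[i].
Implicit Types (S : {vspace 'cV[R]_(n + n)}) (M : 'M[R]_(n + n)).

(** Each condition is a family of linear equations or inequalities in the matrix, and so passes to
    the closure. *)
Lemma closure_eta_plus S N : closure (eta_plus S) N -> Defs.eta S N /\ psd N.
Proof.
move=> cN.
have lieN : sp_lie N.
  apply: sp_lieP => v w; apply/eqP; rewrite -addr_eq0; apply/eqP.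
  apply: (closure_scalar_eq0 (f := fun M => sympQ (M *m v) w + sympQ v (M *m w))) cN.
    move=> a M M'; rewrite !mulmxDl -!scalemxAl !(sympQDl, sympQDr, sympQZl, sympQZr).
    by rewrite /= mulrDr addrACA.
  by move=> M [[hM _] _]; rewrite sympQ_lie // addNr.
split; split=> // v.
  (* Membership in [S] is rewritten as the vanishing of the entries of a vector that depends
     linearly on the matrix. *)
  suff : N *m v - projv S (N *m v) = 0.
    by move/eqP; rewrite subr_eq0 => /eqP ->; exact: memv_proj.
  apply/matrixP => i j; rewrite [RHS]mxE.
  apply: (closure_scalar_eq0
    (f := fun M => (M *m v - projv S (M *m v)) i j)) cN.
    move=> a M M'; rewrite mulmxDl -scalemxAl linearD linearZ /= opprD addrACA -scalerBr.
    by rewrite !mxE.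
  by move=> M [[_ /(_ v) MS] _]; rewrite projv_id // subrr mxE.
apply: (closure_scalar_ge0 (f := fun M => sympQ v (M *m v))) cN.
  by move=> a M M'; rewrite mulmxDl -scalemxAl sympQDr sympQZr.
(* Strict positivity holds off [perp S]; on [perp S] the value is zero because [M *m v] lies in
   [S]. *)
move=> M [[hM MS] pM]; have [Sv|/pM/ltW//] := pselect (perp S v).
by rewrite Sv.
Qed.

(** [Q(w, M M' v) = - Q(M w, M' v)], and both arguments on the right lie in the isotropic space
    [S]. *)
Lemma eta_mul0 S M M' : isotropic S ->
  Defs.eta S M -> Defs.eta S M' -> M *m M' = 0.
Proof.
move=> iS [lM MS] [_ M'S].
have h (v : 'cV_(n + n)) : M *m (M' *m v) = 0.
  apply: sympQ_nondeg => w; have := sympQ_lie w (M' *m v) lM.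
  by rewrite iS // => /eqP; rewrite eq_sym oppr_eq0 => /eqP.
apply/matrixP => i j; have /matrixP /(_ i 0) := h (delta_mx j 0).
by rewrite mulmxA -colE !mxE.
Qed.

Variable l : nat.
Implicit Types (N : 'I_l -> 'M[R]_(n + n)).

(** Real generators are allowed because conjugation by an element of [Gamma] turns rational
    generators into real ones. *)
Definition rcone N : set 'M[R]_(n + n) :=
  [set M | exists2 x : 'I_l -> R, (forall j, 0 <= x j) & M = \sum_j x j *: N j].

Definition polarized N : Prop :=
  (forall j, psd (N j)) /\ forall j k, N j *m N k = 0.

Lemma mem_rcone N j : rcone N (N j).
Proof.
exists (fun k => (k == j)%:R) => [k|]; first by rewrite ler0n.
rewrite (bigD1 j) //= eqxx scale1r big1 ?addr0 // => k /negPf ->.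
by rewrite scale0r.
Qed.

Lemma complex_span_rcone N (M : 'M[C]_(n + n)) :
  complex_span (rcone N) M <-> exists c : 'I_l -> C, M = \sum_j c j *: toC (N j).
Proof.
split=> [[k [c [A [cA ->]]]]|[c ->]]; last first.
  by exists l, c, N; split=> // j; exact: mem_rcone.
have /choice [x xA] : forall i, exists x : 'I_l -> R, A i = \sum_j x j *: N j.
  by move=> i; have [x _ ->] := cA i; exists x.
exists (fun j => \sum_i c i * real_complex R (x i j)).
under eq_bigr => i _ do rewrite xA toC_sum scaler_sumr.
rewrite exchange_big; apply: eq_bigr => j _; rewrite scaler_suml.
by apply: eq_bigr => i _; rewrite toCZ scalerA.
Qed.

Lemma real_span_rcone N M :
  real_span (rcone N) M -> exists c : 'I_l -> R, M = \sum_j c j *: N j.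
Proof.
move=> [k [c [A [cA ->]]]].
have /choice [x xA] : forall i, exists x : 'I_l -> R, A i = \sum_j x j *: N j.
  by move=> i; have [x _ ->] := cA i; exists x.
exists (fun j => \sum_i c i * x i j).
under eq_bigr => i _ do rewrite xA scaler_sumr.
rewrite exchange_big; apply: eq_bigr => j _; rewrite scaler_suml.
by apply: eq_bigr => i _; rewrite scalerA.
Qed.

(** The generators may be dependent, so the coefficients of a nearby [M] in the span must be chosen
    with care. The pseudo-inverse gives coefficients [z] of [M - N0] bounded linearly by its
    entries; with the radius [(c + 1)^-1] they are at most 1 in absolute value, and [1 + z] is
    nonnegative. *)
Lemma relint_sum N : relint (rcone N) (\sum_j N j).
Proof.
split; first by exists (fun=> 1) => //; apply: eq_bigr => j _; rewrite scale1r.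
set N0 := \sum_j N j.
pose G := \matrix_(j < l) mxvec (N j).
have GE (y : 'rV_l) : y *m G = mxvec (\sum_j y 0 j *: N j).
  rewrite mulmx_sum_row linear_sum; apply: eq_bigr => j _.
  by rewrite rowK linearZ.
pose c := \sum_k \sum_j `|pinvmx G k j|.
have c0 : 0 <= c by do 2![apply: sumr_ge0 => ? _].
have e0 : 0 < (c + 1)^-1 by rewrite invr_gt0 ltr_wpDl.
apply/near_mxP; exists (c + 1)^-1 => // M MN /real_span_rcone [y yM].
pose D := mxvec (M - N0); pose z := D *m pinvmx G.
have zM : M - N0 = \sum_j z 0 j *: N j.
  apply: (can_inj mxvecK); rewrite -GE /z mulmxKpV //.
  have -> : D = (\row_j (y j - 1)) *m G.
    rewrite GE /D yM /N0 -sumrB; congr mxvec; apply: eq_bigr => j _.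
    by rewrite mxE scalerBl scale1r.
  exact: submxMl.
exists (fun j => 1 + z 0 j) => [j|]; last first.
  under eq_bigr => j _ do rewrite scalerDl scale1r.
  by rewrite big_split /= -zM -/N0 addrC subrK.
have : `|z 0 j| <= 1.
  rewrite mxE; apply: le_trans (ler_norm_sum _ _ _) _.
  apply: (@le_trans _ _ (\sum_k (c + 1)^-1 * `|pinvmx G k j|)).
    apply: ler_sum => k _; rewrite normrM ler_wpM2r //.
    by case/mxvec_indexP: k => i1 i2; rewrite mxvecE !mxE ltW // MN.
  rewrite -mulr_sumr mulrC ler_pdivrMr ?ltr_wpDl // mul1r.
  apply: (@le_trans _ _ c); last by rewrite lerDl.
  by apply: ler_sum => k _; rewrite (bigD1 j) //= lerDl sumr_ge0.
by rewrite ler_norml; lra.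
Qed.

Section Polarized.
Variable N : 'I_l -> 'M[R]_(n + n).
Hypothesis pN : polarized N.

Lemma rcone_psd M : rcone N M -> psd M.
Proof. by case=> x x0 ->; apply: psd_sum => //; case: pN. Qed.

Lemma rcone_mul0 M M' : rcone N M -> rcone N M' -> M *m M' = 0.
Proof.
case=> x _ -> [y _ ->]; rewrite mulmx_suml big1 // => j _.
rewrite mulmx_sumr big1 // => k _.
by rewrite -scalemxAl -scalemxAr (proj2 pN) !scaler0.
Qed.

(** For small [a > 0] the matrix [A - a *: N j] is still in the cone. So [A] is a sum of two
    semidefinite elements, one of them [a *: N j], and its kernel lies in that of [N j]. *)
Lemma relint_factor A : relint (rcone N) A -> forall j, exists X, N j = X *m A.
Proof.
move=> [cA /near_mxP [e e0 he]] j; apply: kernel_factor => v Av.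
pose c := \sum_i \sum_k `|N j i k|.
have c0 : 0 <= c by do 2![apply: sumr_ge0 => ? _].
pose a := e / (c + 1).
have a0 : 0 < a by rewrite divr_gt0 // ltr_wpDl.
have cB : rcone N (A - a *: N j).
  apply: he => [i k|].
    rewrite !mxE addrAC subrr add0r normrN normrM (gtr0_norm a0).
    rewrite /a mulrAC ltr_pdivrMr ?ltr_wpDl // ltr_pM2l //.
    apply: (@le_lt_trans _ _ c); last by rewrite ltrDl.
    rewrite /c (bigD1 i) //= (bigD1 k) //= -addrA lerDl addr_ge0 ?sumr_ge0 // => i' _.
    exact: sumr_ge0.
  have [x x0 ->] := cA.
  exists l, (fun k => x k - (k == j)%:R * a), N; split; first exact: mem_rcone.
  under [RHS]eq_bigr => k _ do rewrite scalerBl.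
  rewrite sumrB; congr (_ - _); rewrite (bigD1 j) //= eqxx mul1r big1 ?addr0 // => k.
  by move=> /negPf ->; rewrite mul0r scale0r.
have : (a *: N j) *m v = 0.
  apply: (@psd_addl_kernel _ _ _ (A - a *: N j)); last by rewrite addrC subrK.
    have -> : a *: N j = \sum_(k < 1) a *: N j by rewrite big_ord1.
    apply: psd_sum => [_|_]; [by case: pN|exact: ltW].
  exact: rcone_psd.
by rewrite -scalemxAl => /eqP; rewrite scaler_eq0 gt_eqF //= => /eqP.
Qed.

(** Interior elements factor through each other, so their kernels agree; [sp_lie_factor] turns this
    into equality of images. *)
Lemma weight2_relint A B : relint (rcone N) A -> relint (rcone N) B ->
  weight2 (toC A) = weight2 (toC B).
Proof.
have kerS A' B' : relint (rcone N) A' -> relint (rcone N) B' ->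
    exists X, A' = X *m B'.
  move=> [[x _ ->] _] /relint_factor /choice [X NX].
  exists (\sum_j x j *: X j); rewrite mulmx_suml; apply: eq_bigr => j _.
  by rewrite -scalemxAl -NX.
have kerC A' B' : relint (rcone N) A' -> relint (rcone N) B' ->
    (kermx_vs (toC B') <= kermx_vs (toC A'))%VS.
  move=> rA rB; have [X ->] := kerS _ _ rA rB; apply/subvP => v vB.
  have /eqP Bv : toC B' *m v == 0 by rewrite -mem_kermx_vs.
  by rewrite mem_kermx_vs toCM -mulmxA Bv mulmx0.
have imC A' B' : relint (rcone N) A' -> relint (rcone N) B' ->
    (mx_image (toC A') fullv <= mx_image (toC B') fullv)%VS.
  move=> rA rB; have [X AX] := kerS _ _ rA rB.
  have [Y ->] := sp_lie_factor (proj1 (rcone_psd (proj1 rA)))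
    (proj1 (rcone_psd (proj1 rB))) AX.
  apply/subvP => _ /mem_mx_image [w _ ->]; apply/mem_mx_image.
  by exists (toC Y *m w); rewrite ?memvf // toCM mulmxA.
move=> rA rB; apply/funext => k; rewrite /weight2.
have -> : kermx_vs (toC A) = kermx_vs (toC B).
  by apply/eqP; rewrite eqEsubv; apply/andP; split; exact: kerC.
suff -> : mx_image (toC A) fullv = mx_image (toC B) fullv by [].
by apply/eqP; rewrite eqEsubv; apply/andP; split; exact: imC.
Qed.

(** The filtration returned by [xget] is identified by evaluating its defining property at the one
    interior point [\sum_j N j], where uniqueness applies. *)
Lemma cone_weight_polarized : cone_weight (rcone N) = weight2 (toC (\sum_j N j)).
Proof.
have N2 A : relint (rcone N) A -> toC A *m toC A = 0.
  by case=> cA _; rewrite -toCM rcone_mul0 //; exact: map_mx0.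
rewrite /cone_weight; set P := [set W | _].
have PW : P (weight2 (toC (\sum_j N j))).
  move=> A rA; rewrite -(weight2_relint rA (relint_sum N)).
  exact/weight2_monodromy/N2.
have /(_ _ (relint_sum N)) := xgetPex (fun=> 0%VS) (ex_intro _ _ PW).
by apply: monodromy_weight_uniq; exact/N2/relint_sum.
Qed.

End Polarized.

End PolarizedCone.

(** * The Deligne splitting of an orbit frame *)

Section OrbitFrames.
Variables (R : realType) (n : nat).
Local Notation C := R[i].
Implicit Types (A : 'M[R]_(n + n)) (b : pred 'I_n) (u : 'I_n -> 'cV[C]_(n + n)).

Definition orbit_vec A b u (k : bool * 'I_n) : 'cV[C]_(n + n) :=
  if k.1 then if b k.2 then toC A *m conjv (u k.2) else conjv (u k.2) else u k.2.

(* For ~~ b a, u a belongs to I^{0,-1} on the Siegel side and to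
   I^{d a, -1 - d a} for the lift; for b a, it belongs to I^{0,0} on both
   sides, and A times its conjugate to I^{-1,-1}. *)
Definition orbit_frame A b u (d : 'I_n -> int) : Prop :=
  [/\ frame (orbit_vec A b u), forall a, ~~ b a -> toC A *m u a = 0,
      forall a, b a -> d a = 0 & forall a, (2 %| d a)%Z].

Definition siegel_flag u : filtration R n := fun r =>
  if r <= - 1 then fullv else if r == 0 then <<map u (enum 'I_n)>>%VS else 0%VS.

Lemma mem_conj_tflag (t : bool * 'I_n -> 'cV[C]_(n + n)) d q v : frame t ->
  v \in conjvs (tflag t d q) <->
  (forall k, - q <= deg d k -> sympQ v (conjv (t k)) = 0).
Proof.
move=> ft; rewrite mem_conjvs (mem_tflag ft); split=> Qv k /Qv.
  by move/(congr1 Num.conj); rewrite -sympQ_conj conjvK rmorph0.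
by move/(congr1 Num.conj); rewrite -sympQ_conj conjvK rmorph0.
Qed.

Section OrbitFrame.
Variables (A : 'M[R]_(n + n)) (b : pred 'I_n) (u : 'I_n -> 'cV[C]_(n + n)).
Variable d : 'I_n -> int.
Hypothesis lieA : sp_lie A.
Hypothesis AA : A *m A = 0.
Hypothesis of_u : orbit_frame A b u d.
Let t := orbit_vec A b u.
Let F := tflag t d.
Let W := weight2 (toC A).
Let ft : frame t. Proof. by case: of_u. Qed.
Let Au a : ~~ b a -> toC A *m u a = 0. Proof. by case: of_u => _ /(_ a). Qed.
Let d0 a : b a -> d a = 0. Proof. by case: of_u => _ _ /(_ a). Qed.
Let ev a : (2 %| d a)%Z. Proof. by case: of_u => _ _ _ /(_ a). Qed.

Lemma mem_siegel v : v \in <<map u (enum 'I_n)>>%VS <-> forall a, sympQ v (u a) = 0.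
Proof.
have -> : <<map u (enum 'I_n)>>%VS = espan t [pred k | ~~ k.1].
  apply/eqP; rewrite eqEsubv; apply/andP; split; apply/span_subvP => x /mapP.
    move=> [a _ ->]; apply/memv_span/mapP; exists (false, a) => //.
    by rewrite mem_enum.
  move=> [[[] a]]; rewrite mem_enum //= => _ ->.
  by apply/memv_span/map_f; rewrite mem_enum.
rewrite (mem_espan ft); split=> [h a|h [[] a] //= _]; last exact: h.
exact: (h (true, a)).
Qed.

Lemma dim_siegel : \dim <<map u (enum 'I_n)>>%VS = n.
Proof.
have /eqP -> : free (map u (enum 'I_n)).
  have -> : map u (enum 'I_n) = map t [seq (false, a) | a <- enum 'I_n].
    by elim: (enum 'I_n) => //= a s ->.
  apply: (frame_free ft); rewrite map_inj_uniq ?enum_uniq //.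
  by move=> x y [->].
by rewrite size_map size_enum_ord.
Qed.

Lemma siegel_isotropic a c : sympQ (u a) (u c) = 0.
Proof. exact: (frame_eq ft (k := (false, a)) (l := (false, c))). Qed.

(** Expansion in the conjugate frame. The coefficients outside [b] vanish since the conjugates of
    those frame vectors are again frame vectors, none of them the partner of [u a]. The two sums are
    the pieces that Deligne's formula asks of an element of [I^{0,0}]. *)
Lemma orbit_vec_conj_span a : b a -> exists x y : 'I_n -> C,
  u a = \sum_(c | b c) x c *: conjv (u c) + \sum_(c | b c) y c *: (toC A *m u c).
Proof.
move=> ba; have fct : frame (fun k => conjv (t k)).
  by move=> k l; rewrite sympQ_conj conjC_eq0 ft.
have := frame_expand fct (u a); set c := (X in \sum_k X k *: _) => eu.
have eu' := eu.
exists (fun e => c (false, e)), (fun e => c (true, e)).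
have c0 k : ~~ b k.2 -> c k = 0.
  move=> nbk; rewrite /c (_ : sympQ _ _ = 0) ?mul0r //.
  case: k nbk => -[] e /= nbe.
    rewrite -[conjv _]/(conjv (u e)).
    have -> : conjv (u e) = t (true, e) by rewrite /t /orbit_vec /= (negPf nbe).
    apply: (frame_eq ft (k := (false, a))); rewrite /swap /=.
    by apply: contraNneq nbe => -[->].
  rewrite /t /orbit_vec /= (negPf nbe) conjvK.
  exact: siegel_isotropic.
rewrite [LHS]eu; have -> (f : bool * 'I_n -> 'cV[C]_(n + n)) :
    \sum_k f k = \sum_e f (true, e) + \sum_e f (false, e).
  rewrite (eq_bigr (fun k => f (k.1, k.2))) => [|[]//].
  by rewrite -(pair_bigA _ (fun x y => f (x, y))) big_bool.
rewrite [LHS]addrC [in RHS]big_mkcond [X in _ = _ + X]big_mkcond.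
apply: f_equal2; apply: eq_bigr => e _.
  have [be|be] := boolP (b e); last by rewrite c0 ?scale0r.
  by rewrite /t /orbit_vec.
have [be|be] := boolP (b e); last by rewrite c0 ?scale0r.
by rewrite /t /orbit_vec /= be conjv_toC conjvK.
Qed.

Lemma orbit_frame_star v : (forall c, b c -> sympQ v (conjv (u c)) = 0) ->
  (forall c, b c -> sympQ v (toC A *m u c) = 0) ->
  forall a, b a -> sympQ v (u a) = 0.
Proof.
move=> h1 h2 a /orbit_vec_conj_span [x [y ->]].
rewrite sympQDr sympQ_sumr big1 => [|c bc]; last by rewrite sympQZr h1 ?mulr0.
rewrite add0r sympQ_sumr.
by apply: big1 => c bc; rewrite sympQZr h2 ?mulr0.
Qed.

Let QA0 v w : toC A *m v = 0 -> sympQ v (toC A *m w) = 0.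
Proof.
move=> Av; have := sympQ_lie v w (sp_lie_toC lieA).
by rewrite Av sympQ0l => /eqP; rewrite eq_sym oppr_eq0 => /eqP.
Qed.

Let W_low (k : int) : k <= - 3 -> W k = 0%VS.
Proof. by rewrite /W /weight2 => ->. Qed.

(** The correction terms have weight at most -3 and vanish; weight -1 itself is the kernel. *)
Lemma mem_deligne_m1 (p : int) v : v \in deligneI W F p (- p - 1) <->
  [/\ v \in F p, toC A *m v = 0 & v \in conjvs (F (- p - 1))].
Proof.
rewrite /deligneI (_ : p + (- p - 1) = - 1); last by ring.
have -> : vsum [set j : nat | (0 < j)%N] (fun j =>
    conjvs (F (- p - 1 - j%:Z)) :&: W (- 1 - j%:Z - 1))%VS = 0%VS.
  apply/eqP; rewrite -subv0; apply: vsum_le => j /= j0.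
  by rewrite (@W_low (_ - _)) ?capv0 //; lia.
rewrite addv0 !memv_cap -[W (- 1)]/(kermx_vs (toC A)) mem_kermx_vs.
split=> [/andP [/andP [-> /eqP ->] /andP [-> _]]//|[-> -> ->]].
by rewrite eqxx.
Qed.

(** Only the correction term [j = 1] survives; it has weight -2, which is the image of [A]. *)
Lemma mem_deligne_0 (p : int) v : v \in deligneI W F p (- p) <->
  v \in F p /\ exists v1 w,
    [/\ v = v1 + toC A *m w, v1 \in conjvs (F (- p)) &
        toC A *m w \in conjvs (F (- p - 1))].
Proof.
rewrite /deligneI subrr.
have -> : vsum [set j : nat | (0 < j)%N] (fun j =>
    conjvs (F (- p - j%:Z)) :&: W (0 - j%:Z - 1))%VS =
    (conjvs (F (- p - 1)) :&: mx_image (toC A) fullv)%VS.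
  apply/eqP; rewrite eqEsubv; apply/andP; split.
    apply: vsum_le => -[//|[|j]] _; first exact: subvv.
    by rewrite (@W_low (_ - _)) ?capv0 ?sub0v //; lia.
  exact: (@vsum_ub _ _ nat [set j : nat | (0 < j)%N] _ 1%N).
rewrite -[W 0]/fullv !capvf memv_cap; split.
  case/andP=> -> /memv_addP [v1 v1F [v2]]; rewrite memv_cap.
  by case/andP=> v2F /mem_mx_image [w _ ev2] ->; split=> //; exists v1, w; rewrite -ev2.
case=> -> [v1 [w [-> v1F v2F]]] /=; apply: memv_add => //.
by rewrite memv_cap v2F /=; apply/mem_mx_image; exists w; rewrite ?memvf.
Qed.

Let tT a : ~~ b a -> t (true, a) = conjv (u a).
Proof. by rewrite /t /orbit_vec /= => /negPf ->. Qed.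
Let tB a : b a -> t (true, a) = toC A *m conjv (u a).
Proof. by rewrite /t /orbit_vec /= => ->. Qed.

Lemma deligne_m1_sub p : (2 %| p)%Z ->
  (deligneI W F p (- p - 1) <= <<map u (enum 'I_n)>>)%VS.
Proof.
move=> evp; apply/subvP => v /mem_deligne_m1 [/(mem_tflag ft) Fv Av].
move=> /(mem_conj_tflag _ _ _ ft) cFv; apply/mem_siegel => a.
have [ba|nba] := boolP (b a).
  have [p0|p0] := leP 0 p.
    by apply: (Fv (false, a)); rewrite /deg /= d0 //; lia.
  apply: orbit_frame_star ba => c bc; last exact: QA0.
  apply: (cFv (false, c)); rewrite /deg /= d0 //.
  by have [q eq] := dvdzP evp; lia.
(* If [d a < - p], then [d a <= - p - 2] by parity, so [conj (u a)] has degree at least [p + 1] and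
   the condition from the conjugate flag applies to it. *)
have [dp|dp] := leP (- p) (d a); first exact: (Fv (false, a)).
have := cFv (true, a); rewrite tT // conjvK; apply; rewrite /deg /=.
have [q eq] := dvdzP evp; have [q' eq'] := dvdzP (ev a).
by lia.
Qed.

Lemma deligne_0_sub p : (deligneI W F p (- p) <= <<map u (enum 'I_n)>>)%VS.
Proof.
apply/subvP => v /mem_deligne_0 [/(mem_tflag ft) Fv [v1 [w [ev1]]]].
move=> /(mem_conj_tflag _ _ _ ft) cF1 /(mem_conj_tflag _ _ _ ft) cF2.
apply/mem_siegel => a; have [ba|nba] := boolP (b a).
  have [p0|p0] := leP 0 p.
    by apply: (Fv (false, a)); rewrite /deg /= d0 //; lia.
  apply: orbit_frame_star ba => c bc; rewrite ev1 sympQDl.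
    rewrite (cF1 (false, c)) ?(cF2 (false, c)) ?addr0 //; rewrite /deg /= d0 //; lia.
  have := cF1 (true, c); rewrite tB // conjv_toC conjvK => ->.
    by rewrite QA0 ?addr0 // mulmxA -toCM AA /toC map_mx0 mul0mx.
  by rewrite /deg /= d0 //; lia.
(* Here [d a < - p] already puts [conj (u a)] in degree at least [p]; the remaining term
   [toC A *m w] is orthogonal to [u a] because [A] kills [u a]. *)
have [dp|dp] := leP (- p) (d a); first exact: (Fv (false, a)).
rewrite ev1 sympQDl.
have := cF1 (true, a); rewrite tT // conjvK => ->; last by rewrite /deg /=; lia.
by rewrite sympQ_lie ?Au ?sympQ0r ?oppr0 ?addr0 //; exact: sp_lie_toC.
Qed.

Lemma even_flag_orbit : even_flag W F = siegel_flag u.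
Proof.
apply/funext => r; rewrite /even_flag /siegel_flag; case: ifP => // _; case: ifP => // _.
apply/eqP; rewrite eqEsubv; apply/andP; split.
  rewrite subv_add; apply/andP; split; apply: vsum_le => p //=.
    exact: deligne_m1_sub.
  by move=> _; exact: deligne_0_sub.
apply/span_subvP => _ /mapP [a _ ->]; have [ba|nba] := boolP (b a).
  apply: (subvP (addvSr _ _)).
  apply: (subvP (@vsum_ub _ _ int [set: int] _ 0 I)).
  have [x [y euv]] := orbit_vec_conj_span ba.
  apply/mem_deligne_0; split.
    by apply: (tflag_vec t (k := (false, a))); rewrite /deg /= d0.
  exists (\sum_(c | b c) x c *: conjv (u c)), (\sum_(c | b c) y c *: u c).
  have eA : toC A *m (\sum_(c | b c) y c *: u c) =
      \sum_(c | b c) y c *: (toC A *m u c).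
    by rewrite mulmx_sumr; apply: eq_bigr => c _; rewrite -scalemxAr.
  rewrite eA; split=> //; apply: memv_suml => c bc; apply: memvZ; rewrite mem_conjvs.
    rewrite conjvK; apply: (tflag_vec t (k := (false, c))).
    by rewrite /deg /= d0.
  rewrite conjv_toC -(tB bc); apply: tflag_vec.
  by rewrite /deg /= d0.
apply: (subvP (addvSl _ _)).
apply: (subvP (@vsum_ub _ _ int [set p : int | (2 %| p)%Z] _ (d a) (ev a))).
apply/mem_deligne_m1; split; [|exact: Au|].
  by apply: (tflag_vec t (k := (false, a))).
rewrite mem_conjvs -(tT nba); apply: tflag_vec.
by rewrite /deg /=; lia.
Qed.

End OrbitFrame.
End OrbitFrames.

(** * The map to the Siegel side and its equivariance *)

Section FiltrationAction.
Variables (R : realType) (n : nat).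
Local Notation C := R[i].
Implicit Types (F : filtration R n) (g : 'M[C]_(n + n)).

Lemma filt_act_comp g g' F : filt_act g (filt_act g' F) = filt_act (g *m g') F.
Proof. by apply/funext => p; rewrite /filt_act mx_image_comp. Qed.

Lemma filt_act1 F : filt_act 1%:M F = F.
Proof.
apply/funext => p; apply/vspaceP => v; apply/mem_mx_image/idP.
  by case=> w wF ->; rewrite mul1mx.
by move=> vF; exists v; rewrite ?mul1mx.
Qed.

Lemma filt_act_siegel g (u : 'I_n -> 'cV[C]_(n + n)) : g \in unitmx ->
  filt_act g (siegel_flag u) = siegel_flag (fun a => g *m u a).
Proof.
move=> ug; apply/funext => p; rewrite /filt_act /siegel_flag.
case: ifP => _; last case: ifP => _; last exact: limg0.
  apply/vspaceP => v; rewrite memvf; apply/mem_mx_image.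
  by exists (invmx g *m v); rewrite ?memvf // mulKVmx.
by rewrite mx_image_span -map_comp.
Qed.

Lemma filt_act_tflag g (t : bool * 'I_n -> 'cV[C]_(n + n)) d :
  filt_act g (tflag t d) = tflag (fun k => g *m t k) d.
Proof. by apply/funext => p; rewrite /filt_act mx_image_tflag. Qed.

End FiltrationAction.

Lemma frame_Sp (K : fieldType) n (g : 'M[K]_(n + n)) t :
  Sp g -> frame t -> frame (fun k => g *m t k).
Proof. by move=> hg ft k l; rewrite sympQ_Sp. Qed.

Section ConeOrbits.
Variables (R : realType) (n l : nat) (N : 'I_l -> 'M[R]_(n + n)).
Local Notation C := R[i].
Hypothesis pN : polarized N.
Implicit Types (M : 'M[C]_(n + n)) (F : filtration R n) (v : 'cV[C]_(n + n)).

Let N0 : 'M[R]_(n + n) := \sum_j N j.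

Lemma cspan_sum : complex_span (rcone N) (toC N0).
Proof.
apply/complex_span_rcone; exists (fun=> 1).
by rewrite /N0 toC_sum; apply: eq_bigr => j _; rewrite scale1r.
Qed.

Lemma cspanD M M' : complex_span (rcone N) M -> complex_span (rcone N) M' ->
  complex_span (rcone N) (M + M').
Proof.
move=> /complex_span_rcone [c ->] /complex_span_rcone [c' ->].
apply/complex_span_rcone; exists (fun j => c j + c' j).
by rewrite -big_split; apply: eq_bigr => j _; rewrite scalerDl.
Qed.

Lemma cspan0 : complex_span (rcone N) 0.
Proof.
apply/complex_span_rcone; exists (fun=> 0).
by rewrite big1 // => j _; rewrite scale0r.
Qed.

Lemma cspan_mul0 M M' : complex_span (rcone N) M -> complex_span (rcone N) M' ->
  M *m M' = 0.
Proof.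
move=> /complex_span_rcone [c ->] /complex_span_rcone [c' ->].
rewrite mulmx_suml big1 // => j _; rewrite mulmx_sumr big1 // => k _.
by rewrite -scalemxAl -scalemxAr -toCM (proj2 pN) /toC map_mx0 !scaler0.
Qed.

Lemma cspan_kernel M v : complex_span (rcone N) M -> toC N0 *m v = 0 -> M *m v = 0.
Proof.
move=> /complex_span_rcone [c ->] N0v; rewrite mulmx_suml big1 // => j _.
have [X ->] := relint_factor pN (relint_sum N) j.
by rewrite -scalemxAl toCM -mulmxA N0v mulmx0 scaler0.
Qed.

Lemma cspan_conj M v : complex_span (rcone N) M -> toC N0 *m conjv (M *m v) = 0.
Proof.
move=> cM; rewrite -conjv_toC mulmxA (cspan_mul0 cspan_sum cM) mul0mx.
exact: conjv0.
Qed.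

Lemma cspan_lie M : complex_span (rcone N) M -> sp_lie M.
Proof.
move=> /complex_span_rcone [c ->]; apply: sp_lie_sum => j.
by apply: sp_lie_toC; case: pN => /(_ j) [].
Qed.

Lemma exp_orbitE F : exp_orbit (rcone N) F =
  [set filt_act (1%:M + M) F | M in complex_span (rcone N)].
Proof.
have expE M : complex_span (rcone N) M -> expmx M = 1%:M + M.
  by move=> cM; apply: expmx_nilp2; exact: cspan_mul0.
by apply/seteqP; split=> _ [M cM <-]; exists M => //; rewrite (expE M cM).
Qed.

Lemma Sp_one_plus (K : fieldType) (M : 'M[K]_(n + n)) :
  sp_lie M -> M *m M = 0 -> Sp (1%:M + M).
Proof.
move=> lM M2; rewrite /Sp /= [(1%:M + M)^T]linearD /= trmx1 mulmxDl mul1mx (sp_lieE lM).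
rewrite mulmxDr mulmx1 mulmxBl -mulmxA M2 mulmx0 subr0.
by rewrite subrK.
Qed.

Lemma cspan_Sp M : complex_span (rcone N) M -> Sp (1%:M + M).
Proof. by move=> cM; apply: Sp_one_plus; [exact: cspan_lie|exact: cspan_mul0]. Qed.

Lemma filt_act_cspanD M M' F :
  complex_span (rcone N) M -> complex_span (rcone N) M' ->
  filt_act (1%:M + M) (filt_act (1%:M + M') F) = filt_act (1%:M + (M + M')) F.
Proof.
move=> cM cM'; rewrite filt_act_comp; congr (filt_act _ F).
by rewrite mulmxDl mul1mx mulmxDr mulmx1 (cspan_mul0 cM cM') addr0 addrAC addrA.
Qed.

(** [1 + M] is not real, yet it commutes with forming the second half of the frame: outside [b], [M]
    kills both [u a] and its conjugate, and inside [b] the conjugate of [M u] is killed by [N0]. *)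
Lemma orbit_vec_exp b u M : complex_span (rcone N) M ->
  (forall a, ~~ b a -> toC N0 *m u a = 0) ->
  (fun k => (1%:M + M) *m orbit_vec N0 b u k) =
  orbit_vec N0 b (fun a => (1%:M + M) *m u a).
Proof.
move=> cM Nu; apply/funext => -[[] a]; rewrite /orbit_vec /=; last by [].
rewrite !mulmxDl !mul1mx conjvD; case: ifP => [_|/negbT ba].
  by rewrite mulmxDr mulmxA (cspan_mul0 cM cspan_sum) mul0mx addr0 cspan_conj // addr0.
rewrite (cspan_kernel cM (Nu _ ba)) conjv0 (cspan_kernel cM) //.
by rewrite -conjv_toC (Nu _ ba) conjv0.
Qed.

Lemma orbit_frame_exp b u d M : complex_span (rcone N) M ->
  orbit_frame N0 b u d -> orbit_frame N0 b (fun a => (1%:M + M) *m u a) d.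
Proof.
move=> cM [fu Nu d0 ev]; split; [|move=> a /Nu Nua|exact: d0|exact: ev].
  by rewrite -(orbit_vec_exp cM Nu); apply: frame_Sp => //; exact: cspan_Sp.
rewrite mulmxDl mul1mx mulmxDr Nua add0r.
by rewrite (cspan_kernel cM Nua) mulmx0.
Qed.

(** Every flag of the orbit comes from an orbit frame with the same degrees, so [even_flag_orbit]
    computes [even_flag] along the whole orbit and the union in [pev] collapses to one exponential
    orbit. *)
Lemma pev_orbit_frame b u d : orbit_frame N0 b u d ->
  pev (rcone N, exp_orbit (rcone N) (tflag (orbit_vec N0 b u) d)) =
  (rcone N, exp_orbit (rcone N) (siegel_flag u)).
Proof.
move=> ou; have [_ Nu _ _] := ou.
have evE M : complex_span (rcone N) M ->
    even_flag (cone_weight (rcone N)) (filt_act (1%:M + M) (tflag (orbit_vec N0 b u) d)) =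
    filt_act (1%:M + M) (siegel_flag u).
  move=> cM; rewrite (cone_weight_polarized pN) filt_act_tflag (orbit_vec_exp cM Nu).
  rewrite even_flag_orbit.
  - by rewrite filt_act_siegel // Sp_unit //; exact: cspan_Sp.
  - by case: (rcone_psd pN (proj1 (relint_sum N))).
  - by apply: (rcone_mul0 pN); exact: (proj1 (relint_sum N)).
  - exact: orbit_frame_exp.
rewrite /pev; congr (_, _); cbn [fst snd]; rewrite !exp_orbitE; apply/seteqP; split.
  move=> G [_ [M cM <-]]; rewrite exp_orbitE => -[M' cM' <-].
  by rewrite (evE M cM) filt_act_cspanD //; exists (M' + M) => //; exact: cspanD.
move=> _ [M cM <-].
have e0 F : filt_act (1%:M + 0) F = F by rewrite addr0 filt_act1.
exists (tflag (orbit_vec N0 b u) d); first by exists 0; [exact: cspan0|exact: e0].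
have evF := evE _ cspan0; rewrite (e0 (tflag _ _)) (e0 (siegel_flag u)) in evF.
by rewrite exp_orbitE; exists M; [exact: cM|congr filt_act; exact: evF].
Qed.

End ConeOrbits.

Section Equivariance.
Variables (R : realType) (n l : nat) (N : 'I_l -> 'M[R]_(n + n)).
Variable (g : 'M[R]_(n + n)).
Local Notation C := R[i].
Hypothesis pN : polarized N.
Hypothesis hg : Sp g.

Let Ng j := g *m N j *m invmx g.
Let ug : g \in unitmx. Proof. exact: Sp_unit. Qed.

Lemma conj_mxM (K : fieldType) m (h A B : 'M[K]_m) : h \in unitmx ->
  (h *m A *m invmx h) *m (h *m B *m invmx h) = h *m (A *m B) *m invmx h.
Proof. by move=> uh; rewrite !mulmxA mulmxKV. Qed.

Lemma Adjoint_rcone : Adjoint g (rcone N) = rcone Ng.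
Proof.
apply/seteqP; split=> [_ [_ [x x0 ->] <-]|_ [x x0 ->]].
  exists x => //; rewrite mulmx_sumr mulmx_suml; apply: eq_bigr => j _.
  by rewrite -scalemxAr -scalemxAl.
exists (\sum_j x j *: N j); first by exists x.
rewrite mulmx_sumr mulmx_suml; apply: eq_bigr => j _.
by rewrite -scalemxAr -scalemxAl.
Qed.

Lemma polarized_conj : polarized Ng.
Proof.
split=> [j|j k]; last by rewrite /Ng conj_mxM // (proj2 pN) mulmx0 mul0mx.
have [lN pNj] := proj1 pN j.
have QNg v w : sympQ v (Ng j *m w) = sympQ (invmx g *m v) (N j *m (invmx g *m w)).
  by rewrite -[RHS](sympQ_Sp _ _ hg) mulKVmx // !mulmxA.
split; last by move=> v; rewrite QNg.
apply: sp_lieP => v w; rewrite QNg sympQ_antisym QNg -(sympQ_lie _ _ lN).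
by rewrite sympQ_antisym.
Qed.

Lemma point_act_exp_orbit F :
  point_act g (rcone N, exp_orbit (rcone N) F) =
  (rcone Ng, exp_orbit (rcone Ng) (filt_act (toC g) F)).
Proof.
rewrite /point_act /= Adjoint_rcone; congr (_, _).
rewrite (exp_orbitE pN) (exp_orbitE polarized_conj).
pose cg (M : 'M[C]_(n + n)) := toC g *m M *m toC (invmx g).
have gV : toC g *m toC (invmx g) = 1%:M by rewrite -toCM mulmxV // /toC map_mx1.
have Vg : toC (invmx g) *m toC g = 1%:M by rewrite -toCM mulVmx // /toC map_mx1.
have cgE (c : 'I_l -> C) : cg (\sum_j c j *: toC (N j)) = \sum_j c j *: toC (Ng j).
  rewrite /cg mulmx_sumr mulmx_suml; apply: eq_bigr => j _.
  by rewrite -scalemxAr -scalemxAl /Ng !toCM.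
have actE (c : 'I_l -> C) :
    filt_act (toC g) (filt_act (1%:M + \sum_j c j *: toC (N j)) F) =
    filt_act (1%:M + \sum_j c j *: toC (Ng j)) (filt_act (toC g) F).
  rewrite !filt_act_comp; congr (filt_act _ F).
  rewrite -cgE /cg mulmxDr mulmxDl mulmx1 mul1mx.
  by rewrite -(mulmxA _ (toC (invmx g))) Vg mulmx1.
apply/seteqP; split.
  move=> _ [_ [_ /complex_span_rcone [c ->] <-] <-].
  rewrite actE; eexists; last by [].
  by apply/complex_span_rcone; exists c.
move=> _ [_ /complex_span_rcone [c ->] <-].
rewrite -actE; eexists; last by [].
eexists; last by [].
by apply/complex_span_rcone; exists c.
Qed.

Lemma orbit_vec_conj b u :
  (fun k => toC g *m orbit_vec (\sum_j N j) b u k) =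
  orbit_vec (\sum_j Ng j) b (fun a => toC g *m u a).
Proof.
have -> : \sum_j Ng j = g *m (\sum_j N j) *m invmx g.
  by rewrite mulmx_sumr mulmx_suml.
apply/funext => -[[] a]; rewrite /orbit_vec /=; last by [].
rewrite conjv_toC; case: ifP => _; last by [].
by rewrite !mulmxA -!toCM mulmxKV.
Qed.

Lemma orbit_frame_conj b u d :
  orbit_frame (\sum_j N j) b u d ->
  orbit_frame (\sum_j Ng j) b (fun a => toC g *m u a) d.
Proof.
move=> [fu Nu d0 ev]; split; [|move=> a /Nu Nua|exact: d0|exact: ev].
  by rewrite -orbit_vec_conj; apply: frame_Sp fu; exact: Sp_toC.
have -> : \sum_j Ng j = g *m (\sum_j N j) *m invmx g.
  by rewrite mulmx_sumr mulmx_suml.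
by rewrite mulmxA -toCM mulmxKV // toCM -mulmxA Nua mulmx0.
Qed.

(** A real symplectic [g] carries orbit frames to orbit frames of the conjugated cone, where
    [pev_orbit_frame] applies again. *)
Lemma pev_point_act b u d : orbit_frame (\sum_j N j) b u d ->
  pev (point_act g (rcone N, exp_orbit (rcone N) (tflag (orbit_vec (\sum_j N j) b u) d))) =
  point_act g (rcone N, exp_orbit (rcone N) (siegel_flag u)).
Proof.
move=> ou; rewrite !point_act_exp_orbit filt_act_tflag orbit_vec_conj.
rewrite (pev_orbit_frame polarized_conj (orbit_frame_conj ou)).
by rewrite filt_act_siegel // Sp_unit //; exact: Sp_toC.
Qed.

End Equivariance.

(** * Construction of frames *)

Section GramSchmidt.
Variables (K : numClosedFieldType) (V : vectType K).
Variable f : V -> V -> K.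
Hypothesis f_lin : forall a v v' w, f (a *: v + v') w = a * f v w + f v' w.
Hypothesis f_herm : forall v w, f w v = Num.conj (f v w).

Let f0 w : f 0 w = 0.
Proof.
by have := f_lin 1 0 0 w; rewrite scaler0 addr0 mul1r => /eqP;
   rewrite -subr_eq0 opprD addNKr oppr_eq0 => /eqP.
Qed.

Let fN v w : f (- v) w = - f v w.
Proof. by rewrite -[- v]addr0 -scaleN1r f_lin f0 addr0 mulN1r. Qed.

Let fB v v' w : f (v - v') w = f v w - f v' w.
Proof. by rewrite -[v]scale1r f_lin mul1r fN scale1r. Qed.

Let fsum (s : seq V) (c : V -> K) w :
  f (\sum_(x <- s) c x *: x) w = \sum_(x <- s) c x * f x w.
Proof.
elim: s => [|x s IHs]; first by rewrite !big_nil f0.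
by rewrite !big_cons f_lin IHs.
Qed.

Lemma pairwise_orth s x y : pairwise (fun v w => f v w == 0) s ->
  x \in s -> y \in s -> x != y -> f x y = 0.
Proof.
elim: s => // z s IHs /= /andP [/allP zs ps]; rewrite !inE.
move=> /orP [/eqP ->|xs] /orP [/eqP ->|ys]; rewrite ?eqxx // => xy.
- by apply/eqP/zs.
- by rewrite f_herm (eqP (zs x xs)) rmorph0.
- exact: IHs.
Qed.

Lemma herm_span (s : seq V) v w :
  v \in <<s>>%VS -> (forall x, x \in s -> f x w = 0) -> f v w = 0.
Proof.
move=> /(@coord_span _ _ _ (in_tuple s)) -> h.
elim/big_rec: _ => [|i x _ IH]; first exact: f0.
by rewrite f_lin IH h ?mulr0 ?addr0 // mem_nth.
Qed.

Variable L : {vspace V}.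
Hypothesis f_pos : forall v, v \in L -> v != 0 -> 0 < f v v.

Definition orth_in (s : seq V) : Prop :=
  [/\ {subset s <= L}, 0 \notin s & pairwise (fun v w => f v w == 0) s].

Lemma orth_free s : orth_in s -> free s.
Proof.
elim: s => [|v s IHs] [sL s0 /=]; first by rewrite nil_free.
case/andP=> /allP vs ps; rewrite free_cons IHs ?andbT; last first.
  split=> // [x xs|]; first by rewrite sL // inE xs orbT.
  by apply: contra s0; rewrite inE => ->; rewrite orbT.
have v0 : v != 0 by apply: contraNneq s0 => <-; rewrite mem_head.
apply/negP => vS; have := f_pos (sL v (mem_head _ _)) v0.
rewrite (herm_span vS) ?ltxx // => x xs.
by rewrite f_herm (eqP (vs x xs)) rmorph0.
Qed.

(** Stated as an extension of a given orthogonal list, since part of a frame has to be kept fixed.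
    The induction is on the missing dimension, and vectors are not normalized. *)
Lemma gram_schmidt s : orth_in s ->
  exists s', orth_in (s ++ s') /\ <<s ++ s'>>%VS = L.
Proof.
have [m mP] : exists m, (\dim L - size s)%N = m by eexists.
elim: m s mP => [|m IHm] s sm os.
  exists [::]; rewrite cats0; split=> //; have [sL _ _] := os.
  apply/eqP; rewrite eqEdim; apply/andP; split; first exact/span_subvP.
  by have /eqP -> := orth_free os; rewrite -subn_eq0 sm.
have [sL s0 ps] := os.
have dS := orth_free os; rewrite /free in dS.
have /subvPn [v vL vS] : ~~ (L <= <<s>>)%VS.
  by apply/negP => /dimvS; rewrite (eqP dS) -subn_eq0 sm.
pose v' := v - \sum_(x <- s) (f v x / f x x) *: x.
have sumS : \sum_(x <- s) (f v x / f x x) *: x \in <<s>>%VS.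
  by rewrite big_seq; apply: memv_suml => x xs; apply/memvZ/memv_span.
have v'L : v' \in L.
  by rewrite memvB //; apply: subvP sumS; apply/span_subvP.
have v'0 : v' != 0.
  by apply: contraNneq vS => /eqP; rewrite subr_eq0 => /eqP ->.
have v's x : x \in s -> f v' x = 0.
  move=> xs; rewrite fB fsum (bigD1_seq x) //= ?(free_uniq (orth_free os)) //.
  have x0 : x != 0 by apply: contraNneq s0 => <-.
  rewrite divfK ?gt_eqF ?f_pos ?sL // big1_seq ?addr0 ?subrr // => y /andP [yx ys].
  by rewrite (pairwise_orth ps ys xs yx) mulr0.
have os' : orth_in (rcons s v').
  split.
  - by move=> x; rewrite mem_rcons inE => /orP [/eqP -> //|/sL].
  - by rewrite mem_rcons inE negb_or eq_sym v'0.
  - rewrite pairwise_rcons ps andbT; apply/allP => x xs /=.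
    by rewrite f_herm v's // rmorph0.
have [|s' [os'' eL]] := IHm (rcons s v') _ os'; first by rewrite size_rcons subnS sm.
by exists (v' :: s'); rewrite -cat_rcons.
Qed.

End GramSchmidt.

Section PolarizationForm.
Variables (R : realType) (n : nat).
Local Notation C := R[i].
Implicit Types (A : 'M[R]_(n + n)) (v w : 'cV[C]_(n + n)).

(** On the diagonal and for [2 *: A], this is the form [i Q(v, conj v)] pulled back along
    [exp(i A)]; see [polform_exp]. *)
Definition polform A v w : C :=
  'i * sympQ v (conjv w) + sympQ v (toC A *m conjv w).

Lemma polform_lin A a v v' w :
  polform A (a *: v + v') w = a * polform A v w + polform A v' w.
Proof.
rewrite /polform !sympQDl !sympQZl.
move: (sympQ v (conjv w)) (sympQ v' (conjv w)) => p p'.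
move: (sympQ v (toC A *m conjv w)) (sympQ v' (toC A *m conjv w)) => q q'.
by ring.
Qed.

Lemma sympQ_toC_herm A v w : sp_lie A ->
  sympQ w (toC A *m conjv v) = Num.conj (sympQ v (toC A *m conjv w)).
Proof.
move=> lA; rewrite -sympQ_conj conjv_toC conjvK sympQ_antisym sympQ_lie.
  by rewrite opprK.
exact: sp_lie_toC.
Qed.

Lemma polform_herm A v w : sp_lie A -> polform A w v = Num.conj (polform A v w).
Proof.
move=> lA; rewrite /polform rmorphD rmorphM /= -sympQ_toC_herm // conjCi.
by rewrite -sympQ_conj conjvK (sympQ_antisym w); ring.
Qed.

(** For [v = x + i y] with [x] and [y] real, the mixed terms cancel by symmetry and
    [Q(x, A x) + Q(y, A y)] remains. *)
Lemma psd_complex A v : psd A -> 0 <= sympQ v (toC A *m conjv v) /\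
  (sympQ v (toC A *m conjv v) = 0 -> toC A *m v = 0).
Proof.
move=> pA; have [x [y ->]] := cV_decomp v.
have cx (z : 'cV[R]_(n + n)) : conjv (toC z) = toC z.
  by apply/matrixP => i j; rewrite !mxE; exact: conj_real.
have -> : sympQ (toC x + 'i *: toC y) (toC A *m conjv (toC x + 'i *: toC y)) =
    real_complex R (sympQ x (A *m x) + sympQ y (A *m y)).
  rewrite conjvD conjvZ !cx conjCi mulmxDr -scalemxAr -!toCM.
  rewrite !(sympQDl, sympQDr, sympQZl, sympQZr) !sympQ_toC.
  rewrite (psd_sym y x pA) rmorphD /=.
  have := sqrCi C; rewrite expr2; set i := 'i => ii.
  have -> (p q r : C) : p + - i * q + (i * q + i * (- i * r)) = p - (i * i) * r by ring.
  by rewrite ii; ring.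
have [x0 y0] := ((proj2 pA) x, (proj2 pA) y).
split; first by rewrite (lecR 0) addr_ge0.
move=> /eqP; rewrite -(rmorph0 (real_complex R)) (inj_eq (@complexI R)).
rewrite paddr_eq0 // => /andP [/eqP hx /eqP hy].
rewrite mulmxDr -scalemxAr -!toCM (psd_kernel pA hx) (psd_kernel pA hy).
by rewrite /toC map_mx0 scaler0 addr0.
Qed.

Lemma polform_exp A v : sp_lie A -> A *m A = 0 ->
  'i * sympQ ((1%:M + 'i *: toC A) *m v) (conjv ((1%:M + 'i *: toC A) *m v)) =
  polform (2 *: A) v v.
Proof.
move=> lA AA; have lC := sp_lie_toC lA.
have AAC w : toC A *m (toC A *m w) = 0.
  by rewrite mulmxA -toCM AA /toC map_mx0 mul0mx.
rewrite mulmxDl mul1mx -scalemxAl conjvD conjvZ conjCi conjv_toC /polform.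
rewrite !(sympQDl, sympQDr, sympQZl, sympQZr) !(sympQ_lie _ _ lC) AAC sympQ0r.
rewrite toCZ -scalemxAl sympQZr rmorph_nat.
set p := sympQ _ _; set q := sympQ _ _.
have := sqrCi C; rewrite expr2; set i := 'i => ii.
have -> : i * (p + - i * q + (i * - q + i * (- i * - 0))) = i * p - (i * i) * q *+ 2 by ring.
by rewrite ii; ring.
Qed.

Lemma orbit_vec_frame A (b : pred 'I_n) (u : 'I_n -> 'cV[C]_(n + n)) :
  sp_lie A -> A *m A = 0 -> (forall a c, sympQ (u a) (u c) = 0) ->
  (forall a, ~~ b a -> toC A *m u a = 0) ->
  (forall a c, a != c -> sympQ (u a) (orbit_vec A b u (true, c)) = 0) ->
  (forall a, sympQ (u a) (orbit_vec A b u (true, a)) != 0) ->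
  frame (orbit_vec A b u).
Proof.
move=> lA AA Quu Au Qut Qua.
have lC := sp_lie_toC lA.
have QAA v w : sympQ (toC A *m v) (toC A *m w) = 0.
  by rewrite sympQ_lie // mulmxA -toCM AA /toC map_mx0 mul0mx sympQ0r oppr0.
have Auc a : ~~ b a -> toC A *m conjv (u a) = 0.
  by move=> /Au h; rewrite -conjv_toC h conjv0.
have Qtt a c : sympQ (orbit_vec A b u (true, a)) (orbit_vec A b u (true, c)) = 0.
  rewrite /orbit_vec /=; case: ifPn => ba; case: ifPn => bc.
  - exact: QAA.
  - by rewrite sympQ_lie // Auc // sympQ0r oppr0.
  - by rewrite sympQ_antisym sympQ_lie // Auc // sympQ0r !oppr0.
  - by rewrite sympQ_conj Quu rmorph0.
have swap_neq e (a c : 'I_n) : ((e, a) != swap (e, c)) = true.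
  by apply/eqP => -[]; case: e.
have swap_eq e (a c : 'I_n) : ((~~ e, a) != swap (e, c)) = (a != c).
  by rewrite /swap /= xpair_eqE eqxx.
move=> [[] a] [[] c].
- by rewrite Qtt eqxx swap_neq.
- rewrite (swap_eq true c a) sympQ_antisym oppr_eq0 -[orbit_vec A b u (false, c)]/(u c).
  have [->|ca] := eqVneq c a; first exact: (negbTE (Qua a)).
  by rewrite Qut ?eqxx.
- rewrite (swap_eq false c a) -[orbit_vec A b u (false, a)]/(u a).
  have [->|ca] := eqVneq c a; first exact: (negbTE (Qua a)).
  by rewrite Qut ?eqxx // eq_sym.
- by rewrite swap_neq -[sympQ _ _]/(sympQ (u a) (u c)) Quu eqxx.
Qed.

Lemma siegel_frame A (L : {vspace 'cV[C]_(n + n)}) (r : R) :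
  psd A -> A *m A = 0 -> \dim L = n ->
  (forall v w, v \in L -> w \in L -> sympQ v w = 0) ->
  (forall v, v \in L -> v != 0 -> 0 < polform (r *: A) v v) ->
  exists (m : nat) (u : 'I_n -> 'cV[C]_(n + n)), let b := [pred a : 'I_n | (m <= a)%N] in
    [/\ (m <= n)%N, forall a, u a \in L, frame (orbit_vec A b u),
        forall a, ~~ b a -> toC A *m u a = 0 &
        (forall a, ~~ b a -> 0 < 'i * sympQ (u a) (conjv (u a)))].
Proof.
move=> pA AA dL iL posL; have lA := proj1 pA.
have lrA : sp_lie (r *: A).
  by have := @sp_lie_sum _ _ 'I_1 (index_enum 'I_1) (fun=> r) (fun=> A) (fun=> lA);
     rewrite big_ord1.
pose f := polform (r *: A).
have f_lin a v v' w : f (a *: v + v') w = a * f v w + f v' w by exact: polform_lin.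
have f_herm v w : f w v = Num.conj (f v w) by exact: polform_herm.
(* On this part [f] reduces to [i Q(v, conj w)]. *)
pose P := (L :&: kermx_vs (toC A))%VS.
have PL v : v \in P -> v \in L by rewrite memv_cap => /andP [].
have PA v : v \in P -> toC A *m v = 0 by rewrite memv_cap mem_kermx_vs => /andP [_ /eqP].
have PAc v : v \in P -> toC A *m conjv v = 0.
  by move=> /PA h; rewrite -conjv_toC h conjv0.
have fP v w : w \in P -> f v w = 'i * sympQ v (conjv w).
  by move=> wP; rewrite /f /polform toCZ -scalemxAl PAc // scaler0 sympQ0r addr0.
have posP v : v \in P -> v != 0 -> 0 < f v v by move=> /PL; exact: posL.
have [e [oe eP]] : exists s', orth_in f P ([::] ++ s') /\ <<[::] ++ s'>>%VS = P.
  by apply: gram_schmidt.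
rewrite /= in oe eP.
have oeL : orth_in f L e by have [h1 h2 h3] := oe; split=> // x /h1 /PL.
have [b0 [ob0 eL]] := gram_schmidt f_lin f_herm posL oeL.
have fre := orth_free f_lin f_herm posL ob0.
have sz : (size e + size b0)%N = n.
  by rewrite -size_cat -(eqP fre) eL.
(* The list [b0] is orthogonal for [f], but a frame needs orthogonality for [g]. Only the span of
   [b0] is kept, and [gram_schmidt] is run again inside it. *)
pose B := <<b0>>%VS; pose g v w := sympQ v (toC A *m conjv w).
have BL v : v \in B -> v \in L.
  by move=> vB; rewrite -eL span_cat; apply: (subvP (addvSr _ _)).
have [_ e0 pe] := ob0; rewrite pairwise_cat in pe.
have {pe} [/allrelP pe0 _ _] := and3P pe.
have feB v w : v \in B -> w \in P -> f v w = 0.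
  move=> vB wP; apply: (herm_span f_lin vB) => x xb; rewrite f_herm.
  rewrite (herm_span f_lin (s := e)) ?rmorph0 // ?eP // => y ye.
  exact/eqP/pe0.
have g_lin a v v' w : g (a *: v + v') w = a * g v w + g v' w.
  by rewrite /g sympQDl sympQZl.
have g_herm v w : g w v = Num.conj (g v w) by exact: sympQ_toC_herm.
(* A null vector of [g] in [B] is killed by [A], hence lies in [P]; but [B] is orthogonal to [P] for
   [f], which is positive on [P]. *)
have posB v : v \in B -> v != 0 -> 0 < g v v.
  move=> vB v0; have [ge0 gker] := psd_complex v pA.
  rewrite lt_def ge0 andbT; apply: contra v0 => /eqP /gker Av.
  have vP : v \in P by rewrite memv_cap BL // mem_kermx_vs Av eqxx.
  apply/negPn/negP => v0; have := posP v vP v0.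
  by rewrite feB // ltxx.
have [b [ob bB]] : exists s', orth_in g B ([::] ++ s') /\ <<[::] ++ s'>>%VS = B.
  by apply: gram_schmidt.
rewrite /= in ob bB.
have szb : size b = size b0.
  have /eqP <- := orth_free g_lin g_herm posB ob.
  rewrite bB; apply/eqP; move: fre; rewrite cat_free => /and3P [_ fb _].
  exact: fb.
have ue : uniq e := free_uniq (orth_free f_lin f_herm posP oe).
have ub : uniq b := free_uniq (orth_free g_lin g_herm posB ob).
pose u (a : 'I_n) := nth 0 (e ++ b) a.
have ltb (a : 'I_n) : (size e <= a)%N -> (a - size e < size b)%N.
  by move=> ae; rewrite szb ltn_subLR // sz.
have uE (a : 'I_n) : ~~ (size e <= a)%N -> u a = nth 0 e a /\ u a \in e.
  by rewrite -ltnNge => ae; rewrite /u nth_cat ae mem_nth.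
have uB (a : 'I_n) : (size e <= a)%N -> u a = nth 0 b (a - size e) /\ u a \in b.
  by move=> ae; rewrite /u nth_cat ltnNge ae /= mem_nth ?ltb.
have [eP' e0' pe] := oe; have [bB' b0' pb] := ob.
have uL a : u a \in L.
  have [/uB [_ /bB' /BL //]|/uE [_ /eP' /PL //]] := boolP (size e <= a)%N.
exists (size e), u; split=> //.
- by have := leq_addr (size b0) (size e); rewrite sz.
- apply: orbit_vec_frame => // [a c|a /uE [_ /eP' /PA //]|a c ac|a].
  + exact: iL.
  + rewrite /orbit_vec /=; case: ifPn => hc.
      have [uc cb] := uB _ hc.
      have [ha|ha] := boolP (size e <= a)%N; last first.
        have [_ /eP' /PA ua] := uE _ ha.
        have := sympQ_lie (u a) (conjv (u c)) (sp_lie_toC lA).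
        by rewrite ua sympQ0l => /eqP; rewrite eq_sym oppr_eq0 => /eqP.
      have [ua ab] := uB _ ha.
      apply: (pairwise_orth g_herm pb ab cb); rewrite ua uc nth_uniq //.
      * apply: contraNneq ac => h; apply/eqP/val_inj.
        by rewrite /= -(subnK ha) h subnK.
      * exact: ltb.
      * exact: ltb.
    have [uc ce] := uE _ hc; have cP := eP' _ ce.
    have fac : f (u a) (u c) = 0.
      have [ha|ha] := boolP (size e <= a)%N.
        by have [_ /bB' ab] := uB _ ha; exact: feB.
      have [ua ae] := uE _ ha.
      apply: (pairwise_orth f_herm pe ae ce); rewrite ua uc nth_uniq //.
      * by rewrite ltnNge.
      * by rewrite ltnNge.
    have := fP (u a) _ cP; rewrite fac => /eqP; rewrite eq_sym mulf_eq0.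
    by rewrite (negPf (neq0Ci C)) => /eqP.
  + rewrite /orbit_vec /=; case: ifPn => ha.
      have [_ ab] := uB _ ha; rewrite gt_eqF //; apply: posB; first exact: bB'.
      by apply: contraNneq b0' => <-.
    have [_ ae] := uE _ ha; have aP := eP' _ ae.
    have : 0 < f (u a) (u a).
      by apply: posP => //; apply: contraNneq e0' => <-.
    by rewrite fP // => h; apply: contraTneq h => ->; rewrite mulr0 ltxx.
- by move=> a /uE [_ /eP' /PA].
- move=> a /uE [_ ae]; have aP := eP' _ ae; rewrite -fP //.
  by apply: posP => //; apply: contraNneq e0' => <-.
Qed.

End PolarizationForm.

(** * Frames that define points of the period domain *)

Section PeriodFrames.
Variables (R : realType) (n : nat).
Local Notation C := R[i].
Implicit Types (u : 'I_n -> 'cV[C]_(n + n)) (d : 'I_n -> int).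

Lemma compact_dual_tflag (h : {fsfun int -> nat with 0%N})
    (t : bool * 'I_n -> 'cV[C]_(n + n)) d : frame t ->
  (forall p, #|[pred k | p <= deg d k]| = (\sum_(r <- finsupp h | (p <= r)%R) h r)%N) ->
  compact_dual h (tflag t d).
Proof.
move=> ft hd; split=> [p q|p|p v w]; first exact: tflag_subset.
  by rewrite dim_tflag // hd.
exact: tflag_isotropic.
Qed.

Lemma expz_i4 (e : int) : ('i : C) ^ (4 * e) = 1.
Proof.
rewrite -exprz_exp (_ : 'i ^ 4 = 1) ?exp1rz //.
by rewrite -exprnP (exprM _ 2 2) sqrCi sqrrN expr1n.
Qed.

(** With [A = 0] and [b] empty, the second half of the frame consists of the conjugates of the
    first, so conjugation acts on the frame as [swap]. The components of the Hodge structure are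
    then spanned by the frame vectors of a given degree, and these are orthogonal for the
    polarization. *)
Lemma period_domain_frame (h : {fsfun int -> nat with 0%N}) u d :
  let t := orbit_vec 0 pred0 u in frame t ->
  (forall a, 0 < 'i * sympQ (u a) (conjv (u a))) -> (forall a, (2 %| d a)%Z) ->
  (forall p, #|[pred k | p <= deg d k]| = (\sum_(r <- finsupp h | (p <= r)%R) h r)%N) ->
  period_domain h (tflag t d).
Proof.
move=> t ft posu ev hd.
have ct k : conjv (t k) = t (swap k).
  by case: k => -[] a; rewrite /t /orbit_vec /= ?conjvK.
have memF q v : v \in conjvs (tflag t d q) <->
    forall k, - q <= deg d k -> sympQ v (t (swap k)) = 0.
  by rewrite (mem_conj_tflag _ _ _ ft); split=> H k /H; rewrite ct.
split; first exact: compact_dual_tflag.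
  move=> p; split.
    apply/vspaceP => v; rewrite memvf (frame_expand ft v).
    apply: memv_suml => k _; apply: memvZ.
    have [pk|pk] := leP p (deg d k).
      by apply: (subvP (addvSl _ _)); exact: tflag_vec.
    apply: (subvP (addvSr _ _)); rewrite mem_conjvs ct; apply: tflag_vec.
    by rewrite deg_swap; lia.
  apply/eqP; rewrite -subv0; apply/subvP => v; rewrite memv_cap memv0.
  case/andP=> /(mem_tflag ft) F1 /memF F2; apply/eqP/(frame_nondeg ft) => k.
  have [pk|pk] := leP (- p) (deg d k); first exact: F1.
  by rewrite -(swapK k) F2 // deg_swap; lia.
move=> p q pq v; rewrite /hodge_component memv_cap.
case/andP=> /(mem_tflag ft) F1 /memF F2 v0.
pose c k := sympQ v (t (swap k)) / sympQ (t k) (t (swap k)).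
have ev' : v = \sum_k c k *: t k := frame_expand ft v.
have c0 k : deg d k != p -> c k = 0.
  move=> kp; rewrite /c; have [pk|pk] := ltP (deg d k) p.
    by rewrite F1 ?mul0r // deg_swap; lia.
  by rewrite F2 ?mul0r //; lia.
have Qvv : sympQ v (conjv v) = \sum_k `|c k| ^+ 2 * sympQ (t k) (t (swap k)).
  rewrite {1}ev' sympQ_suml; apply: eq_bigr => k _; rewrite sympQZl normCK.
  have Qk : sympQ v (t (swap k)) = c k * sympQ (t k) (t (swap k)).
    by rewrite /c divfK // frame_neq0.
  suff -> : sympQ (t k) (conjv v) = Num.conj (c k) * sympQ (t k) (t (swap k)).
    by rewrite !mulrA.
  rewrite -[t k in LHS]conjvK sympQ_conj ct sympQ_antisym Qk.
  rewrite rmorphN rmorphM /= -sympQ_conj !ct swapK.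
  by rewrite (sympQ_antisym (t k)) mulrN opprK.
(* As [p - q = 2 p + 1], the factor is [i] for even [p] and [- i] for odd [p]; in the odd case the
   sign is compensated by exchanging [u a] and its conjugate. *)
have posk k : deg d k = p -> 0 < 'i ^ (p - q) * sympQ (t k) (t (swap k)).
  have -> : p - q = 2 * p + 1 by lia.
  case: k => -[] a; rewrite /deg /= => <-; have [e eqd] := dvdzP (ev a).
    rewrite (_ : _ + 1 = 4 * (- e) + - 1); last by rewrite eqd; lia.
    rewrite expfzDr ?neq0Ci // expz_i4 mul1r -exprz_inv expr1z invCi.
    by rewrite -[t (true, a)]/(conjv (u a)) sympQ_antisym mulNr mulrN opprK; exact: posu.
  rewrite (_ : _ + 1 = 4 * e + 1); last by rewrite eqd; lia.
  by rewrite expfzDr ?neq0Ci // expz_i4 mul1r expr1z; exact: posu.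
rewrite Qvv mulr_sumr.
have ge0 k : 0 <= 'i ^ (p - q) * (`|c k| ^+ 2 * sympQ (t k) (t (swap k))).
  have [kp|kp] := eqVneq (deg d k) p; last by rewrite c0 // normr0 expr0n mul0r mulr0.
  by rewrite mulrCA mulr_ge0 ?exprn_ge0 // ltW // posk.
rewrite lt_def sumr_ge0 // andbT; apply: contra v0 => /eqP /psumr_eq0P S0.
rewrite ev' big1 // => k _; have [kp|kp] := eqVneq (deg d k) p; last by rewrite c0 ?scale0r.
have := S0 (fun i _ => ge0 i) k isT; rewrite mulrCA => /eqP.
rewrite mulf_eq0 (gt_eqF (posk k kp)) orbF expf_eq0 /= normr_eq0 => /eqP ->.
by rewrite scale0r.
Qed.

(** The vectors [u a] outside [b] extend to an orthogonal basis [u'] of the span of [u]. The frame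
    made of [u'] and its conjugates has the same flag, and [period_domain_frame] applies to it. *)
Lemma period_domain_orbit_frame (h : {fsfun int -> nat with 0%N})
    (A : 'M[R]_(n + n)) m u d :
  let b := [pred a : 'I_n | (m <= a)%N] in
  sp_lie A -> A *m A = 0 -> (m <= n)%N -> orbit_frame A b u d ->
  (forall v, v \in <<map u (enum 'I_n)>>%VS -> v != 0 -> 0 < 'i * sympQ v (conjv v)) ->
  (forall p, #|[pred k | p <= deg d k]| = (\sum_(r <- finsupp h | (p <= r)%R) h r)%N) ->
  period_domain h (tflag (orbit_vec A b u) d).
Proof.
move=> b lA AA mn ou posL hd; have [ft Au d0 ev] := ou.
set L := <<_>>%VS in posL; set t := orbit_vec A b u in ft *.
have uL a : u a \in L by apply/memv_span/map_f; rewrite mem_enum.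
have iL v w : v \in L -> w \in L -> sympQ v w = 0.
  move=> /(mem_siegel ou) Qv wL; rewrite sympQ_antisym (span_sympQ wL) ?oppr0 //.
  by move=> _ /mapP [a _ ->]; rewrite sympQ_antisym Qv oppr0.
have l0 : sp_lie (0 : 'M[R]_(n + n)) by rewrite /sp_lie /= trmx0 mul0mx mulmx0 addr0.
pose f := @polform R n 0.
have f_lin a v v' w : f (a *: v + v') w = a * f v w + f v' w by exact: polform_lin.
have f_herm v w : f w v = Num.conj (f v w) by exact: polform_herm.
have fE v w : f v w = 'i * sympQ v (conjv w).
  by rewrite /f /polform /toC map_mx0 mul0mx sympQ0r addr0.
have f_pos v : v \in L -> v != 0 -> 0 < f v v by rewrite fE; exact: posL.
pose s := [seq u (widen_ord mn a) | a <- enum 'I_m].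
have u0 a : u a != 0.
  apply/eqP => ua; have := frame_neq0 ft (false, a).
  by rewrite -[t (false, a)]/(u a) ua sympQ0l eqxx.
have s_nth (a : 'I_n) : (a < m)%N -> nth 0 s a = u a.
  move=> am; rewrite (nth_map (Ordinal am)) ?size_enum_ord //; congr u.
  by apply: val_inj; rewrite /= nth_enum_ord.
have os : orth_in f L s.
  split.
  - by move=> _ /mapP [a _ ->].
  - by apply/mapP => -[a _] /eqP; rewrite eq_sym (negPf (u0 _)).
  - rewrite pairwise_map; apply: (@sub_pairwise _ [rel x y | x != y]); last first.
      by rewrite -uniq_pairwise enum_uniq.
    move=> a c /= ac; rewrite fE.
    have -> : conjv (u (widen_ord mn c)) = t (true, widen_ord mn c).
      by rewrite /t /orbit_vec /b /= leqNgt ltn_ord.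
    rewrite -[u _]/(t (false, _)) frame_eq ?mulr0 //.
    by apply: contraNneq ac => -[] ca; apply/eqP/val_inj.
have [s' [oss eL]] := gram_schmidt f_lin f_herm f_pos os.
have sz : size (s ++ s') = n.
  have /eqP <- := orth_free f_lin f_herm f_pos oss.
  by rewrite eL (dim_siegel ou).
pose u' (a : 'I_n) := nth 0 (s ++ s') a.
have szs : size s = m by rewrite size_map size_enum_ord.
have u'u a : ~~ b a -> u' a = u a.
  by rewrite /b /= -ltnNge => am; rewrite /u' nth_cat szs am s_nth.
have u'in a : u' a \in s ++ s' by rewrite mem_nth // sz.
have [ssL ss0 pss] := oss.
have u'L a : u' a \in L by exact: ssL.
have uss : uniq (s ++ s') := free_uniq (orth_free f_lin f_herm f_pos oss).
pose t' := orbit_vec 0 pred0 u'.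
have pos' a : 0 < 'i * sympQ (u' a) (conjv (u' a)).
  by rewrite -fE f_pos //; apply: contraNneq ss0 => <-.
have ft' : frame t'.
  apply: orbit_vec_frame => //.
  - by rewrite mul0mx.
  - by move=> a c; exact: iL.
  - by move=> a _; rewrite /toC map_mx0 mul0mx.
  - move=> a c ac; rewrite -[orbit_vec _ _ _ _]/(conjv (u' c)).
    have : f (u' a) (u' c) = 0.
      apply: (pairwise_orth f_herm pss) => //.
      by rewrite nth_uniq // sz.
    by rewrite fE => /eqP; rewrite mulf_eq0 (negPf (neq0Ci C)) => /eqP.
  - move=> a; rewrite -[orbit_vec _ _ _ _]/(conjv (u' a)).
    by apply: contraTneq (pos' a) => ->; rewrite mulr0 ltxx.
have tt k : ~~ b k.2 -> t' k = t k.
  by case: k => -[] a /= nba; rewrite /t /t' /orbit_vec /= u'u // (negPf nba).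
(* The frames differ only inside [b], where the degrees are 0 and -1. A nonnegative sum there forces
   both degrees to be 0, and then both vectors lie in the isotropic space [L]. *)
have <- : tflag t' d = tflag t d.
  apply: tflag_eq => // k l kl.
  have lk : l != swap k by apply: contraTneq kl => ->; rewrite deg_swap; lia.
  have [bk|nbk] := boolP (b k.2); last by rewrite tt // frame_eq.
  have [bl|nbl] := boolP (b l.2); last by rewrite -tt // frame_eq.
  case: k {lk} bk kl => -[] a ba; case: l bl => -[] c bc; rewrite /deg /= !d0 //.
  all: try lia.
  by move=> _; exact: (iL (u' a) (u c)).
exact: period_domain_frame.
Qed.

End PeriodFrames.

(** * Distribution of the degrees *)

Section DegreeList.
Variables (n : nat) (h : {fsfun int -> nat with 0%N}).
Hypothesis hh : hodge_numbers n h.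

Let full : seq int := flatten [seq nseq (h q) q | q <- finsupp h].

Lemma count_full (P : pred int) :
  count P full = (\sum_(q <- finsupp h | P q) h q)%N.
Proof.
rewrite count_flatten sumnE -map_comp big_map [RHS]big_mkcond; apply: eq_bigr => q _ /=.
by rewrite count_nseq; case: (P q); rewrite ?mul1n ?mul0n.
Qed.

Lemma count_mem_full q : count_mem q full = h q.
Proof.
rewrite count_full big_mkcond /=; have [qh|qh] := boolP (q \in finsupp h); last first.
  rewrite fsfun_dflt // big1_seq // => x /= xh; case: eqP => // xq.
  by rewrite -xq xh in qh.
rewrite (bigD1_seq q) ?fset_uniq //= ifT // big1 ?addn0 // => x /negPf xq.
by rewrite ifF.
Qed.

(** By the symmetry of [h], reflection [q -> - 1 - q] matches the even degrees with the odd ones, so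
    counted with multiplicity there are [n] even degrees. At least [n - m] of them are 0 and can be
    given to the last indices. *)
Lemma degree_list m : (m <= n)%N -> (n - m <= h 0)%N ->
  exists d : 'I_n -> int, [/\ forall a, (2 %| d a)%Z,
    forall a : 'I_n, (m <= a)%N -> d a = 0 &
    forall p, #|[pred k : bool * 'I_n | p <= deg d k]| =
      (\sum_(r <- finsupp h | (p <= r)%R) h r)%N].
Proof.
move=> mn mh; have [hsym hsum] := hh.
pose evn (q : int) := (2 %| q)%Z.
pose ev := [seq q <- full | evn q].
have evC q : count_mem q ev = if evn q then h q else 0%N.
  rewrite count_filter -count_mem_full; case: ifP => eq.
    by apply: eq_count => x /=; apply: andb_idr => /eqP ->.
  apply/eqP; rewrite -leqn0 leqNgt -has_count; apply/hasPn => x _ /=.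
  by apply/negP => /andP [/eqP ->]; rewrite eq.
have pfull : perm_eq (ev ++ [seq - 1 - q | q <- ev]) full.
  apply/allP => q _ /=; apply/eqP; rewrite count_cat count_map count_mem_full.
  have -> : count (preim (fun q => - 1 - q) (pred1 q)) ev = count_mem (- 1 - q) ev.
    by apply: eq_count => x /=; lia.
  rewrite !evC /evn (hsym q).
  have -> : - 1 - q = - q - 1 by lia.
  have -> : (2 %| - q - 1)%Z = ~~ (2 %| q)%Z by lia.
  by case: (2 %| q)%Z; rewrite /= ?addn0.
have szfull : size full = (n + n)%N.
  by rewrite -(count_predT full) count_full -hsum.
have szev : size ev = n.
  by apply: double_inj; rewrite -!addnn -szfull -(perm_size pfull) size_cat size_map.
(* The zeros are taken out of [ev] and put back in two blocks, so that the last [n - m] entries of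
   [ds] are zeros. *)
pose r := [seq q <- ev | q != 0] ++ nseq (h 0 - (n - m)) 0.
pose ds := r ++ nseq (n - m) 0.
have pds : perm_eq ds ev.
  apply/allP => q _ /=; apply/eqP; rewrite /ds /r !count_cat !count_nseq.
  rewrite count_filter; have [->|q0] := eqVneq q 0.
    rewrite /= evC /evn dvdz0 /= !mul1n -addnA subnK //.
    rewrite [X in (X + _)%N](_ : _ = 0%N) //.
    apply/eqP; rewrite -leqn0 leqNgt -has_count; apply/hasPn => x _ /=.
    by case: eqP.
  rewrite /= eq_sym (negPf q0) !mul0n !addn0; apply: eq_count => x /=.
  by apply: andb_idr => /eqP ->.
have szds : size ds = n by rewrite (perm_size pds).
have szr : size r = m.
  have e := size_cat r (nseq (n - m) 0); rewrite -/ds szds size_nseq in e.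
  by apply/eqP; rewrite -(eqn_add2r (n - m)) -e subnKC.
pose d (a : 'I_n) := nth 0 ds a.
have dsE : [seq d a | a <- enum 'I_n] = ds.
  rewrite (map_comp (nth 0 ds) val) val_enum_ord -{1}szds.
  exact: mkseq_nth.
exists d; split=> [a|a am|p].
- have : d a \in ds by rewrite mem_nth ?szds.
  by rewrite (perm_mem pds) mem_filter => /andP [].
- by rewrite /d nth_cat szr ltnNge am /= nth_nseq; case: ifP.
have cE (P : pred int) : count P ds = (\sum_(a < n) P (d a))%N.
  by rewrite -dsE count_map -sum1_count big_enum_cond big_mkcond;
     apply: eq_bigr => a _ /=; case: ifP.
have c1 : count (fun q => p <= q) ev = (\sum_(a < n) (p <= d a)%R)%N.
  by rewrite -(permP pds) cE.
have c2 : count (fun q => p <= q) [seq - 1 - q | q <- ev] =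
    (\sum_(a < n) (p <= - 1 - d a)%R)%N.
  by rewrite count_map -(permP pds) cE.
rewrite -count_full -(permP pfull) count_cat c1 c2 -sum1_card big_mkcond.
transitivity (\sum_(e : bool) \sum_(a < n) ((p <= deg d (e, a))%R : nat))%N.
  rewrite pair_bigA; apply: eq_bigr => -[e a] _; rewrite inE /=.
  by case: ifP.
by rewrite big_bool addnC.
Qed.

End DegreeList.

(** * Dimension counts: Siegel flags and the rank of the nilpotent *)

Section SiegelDimensions.
Variables (R : realType) (n : nat).
Local Notation C := R[i].

Lemma sum_siegel (P : pred int) :
  (\sum_(r <- finsupp (siegel_numbers n) | P r) siegel_numbers n r =
   (if P 0%R then n else 0) + (if P (- 1)%R then n else 0))%N.
Proof.
(* The support is empty for [n = 0], so the sum is first extended to the two degrees 0 and -1. *)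
rewrite big_mkcond /= (@big_fset_incl _ _ _ _ _ [fset 0; - 1]%fset); last 2 first.
- exact: finsupp_sub.
- by move=> x _ xf; rewrite fsfun_dflt //; case: ifP.
rewrite big_fsetU1 ?inE // big_seq_fset1.
by rewrite !fsfunE !inE eqxx orbT /=; case: (P 0); case: (P (- 1)).
Qed.

Lemma siegel_dual_flag (F : filtration R n) (u : 'I_n -> 'cV[C]_(n + n)) :
  compact_dual (siegel_numbers n) F -> F 0 = <<map u (enum 'I_n)>>%VS ->
  siegel_flag u = F.
Proof.
move=> [_ dF _] F0; apply/funext => p; rewrite /siegel_flag.
have dFp := dF p; rewrite sum_siegel in dFp.
case: ifP => p1.
  apply/esym/eqP; rewrite eqEdim subvf dim_cV dFp.
  by rewrite !ifT //; lia.
case: ifP => [/eqP -> //|p0]; move: dFp; rewrite !ifF ?addn0; try lia.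
by move/eqP; rewrite dimv_eq0 => /eqP.
Qed.

(** The [n - m] frame vectors [A (conj (u a))] are independent. Factoring [A] through a real basis
    of [S] puts them in the complex span of [\dim S] columns. *)
Lemma rank_bound (A : 'M[R]_(n + n)) (S : {vspace 'cV[R]_(n + n)}) m
    (u : 'I_n -> 'cV[C]_(n + n)) :
  frame (orbit_vec A [pred a : 'I_n | (m <= a)%N] u) ->
  (forall v : 'cV_(n + n), A *m v \in S) -> (n - m <= \dim S)%N.
Proof.
set b := [pred a | _] => ft AS; set t := orbit_vec A b u in ft.
pose B := \matrix_(i < n + n, j < \dim S) (vbasis S)`_j i 0.
pose X := \matrix_(i < \dim S, j < n + n) coord (vbasis S) i (col j A).
have AE : A = B *m X.
  apply/matrixP => i j; rewrite mxE.
  have : col j A \in S by rewrite colE.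
  move=> /coord_vbasis /matrixP /(_ i 0); rewrite mxE => ->; rewrite summxE.
  by apply: eq_bigr => k _; rewrite !mxE mulrC.
pose T := <<[seq col j (toC B) | j <- enum 'I_(\dim S)]>>%VS.
apply: (@leq_trans (\dim T)); last first.
  by apply: leq_trans (dim_span _) _; rewrite size_map size_enum_ord.
pose P := [pred k : bool * 'I_n | k.1 && b k.2].
have -> : (n - m)%N = \dim (espan t P).
  rewrite dim_espan // -sum1_card big_mkcond.
  transitivity (\sum_(e : bool) \sum_(a < n) ((e && (m <= a)%N) : nat))%N.
    rewrite big_bool /= [X in (_ + X)%N]big1 // addn0.
    elim: (n) => [|k IHk]; first by rewrite big_ord0.
    by rewrite big_ord_recr /= -IHk; case: leqP; lia.
  rewrite pair_bigA; apply: eq_bigr => -[e a] _; rewrite inE /=.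
  by case: ifP.
apply/dimvS/span_subvP => x /mapP [[e a]]; rewrite mem_enum inE /= => /andP [et ba ->].
rewrite et /t /orbit_vec /= ba AE toCM -mulmxA.
set w := toC X *m _.
have -> : toC B *m w = \sum_j w j 0 *: col j (toC B).
  apply/matrixP => i k; rewrite (ord1 k) mxE summxE.
  by apply: eq_bigr => j _; rewrite !mxE mulrC.
by apply: memv_suml => j _; apply/memvZ/memv_span/map_f; rewrite mem_enum.
Qed.

End SiegelDimensions.

(** * Lifting nilpotent orbits *)

Section LiftOrbit.
Variables (R : realType) (n : nat).
Local Notation C := R[i].

(** In the Siegel case [G^{-1}] is everything, so the component of type [(0, -1)] is all of [G^0],
    which contains [exp(i A) v]. *)
Lemma siegel_positive (A : 'M[R]_(n + n)) (F : filtration R n) v :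
  sp_lie A -> A *m A = 0 ->
  period_domain (siegel_numbers n) (filt_act (expmx ('i *: toC A)) F) ->
  v \in F 0 -> v != 0 -> 0 < polform (2 *: A) v v.
Proof.
move=> lA AA; set M := 'i *: toC A.
have MM : M *m M = 0.
  by rewrite /M -scalemxAl -scalemxAr -toCM AA /toC map_mx0 !scaler0.
have lM : sp_lie M.
  apply: sp_lieP => x y; rewrite -!scalemxAl sympQZl sympQZr.
  by rewrite sympQ_lie ?mulrN //; exact: sp_lie_toC.
rewrite (expmx_nilp2 MM) => -[[_ dG _] _ posG] vF v0; rewrite -polform_exp //.
pose w := (1%:M + M) *m v.
have Gfull : filt_act (1%:M + M) F (- 1) = fullv.
  by apply/eqP; rewrite eqEdim subvf dim_cV dG sum_siegel /= leqnn.
have := posG 0 (- 1) erefl w; rewrite (_ : 0 - - 1 = 1) // expr1z; apply.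
  rewrite /hodge_component memv_cap mem_conjvs Gfull memvf andbT.
  by apply/mem_mx_image; exists v.
apply: contra v0 => /eqP w0; rewrite -(mulKmx (Sp_unit (Sp_one_plus lM MM)) v).
by rewrite -/w w0 mulmx0.
Qed.

(** [B] kills every frame vector except the [u a] with [b a], all of degree 0. Moving [B] across the
    form shows that their images are orthogonal to all frame vectors of positive degree. *)
Lemma horizontal_tflag (A B : 'M[R]_(n + n)) b u d p :
  orbit_frame A b u d -> sp_lie B ->
  (forall v : 'cV_(n + n), toC A *m v = 0 -> toC B *m v = 0) ->
  B *m A = 0 ->
  (mx_image (toC B) (tflag (orbit_vec A b u) d p) <=
   tflag (orbit_vec A b u) d (p - 1))%VS.
Proof.
move=> [ft Au d0 ev] lB BA0 BA.
have Bt k : ~~ (b k.2 && ~~ k.1) -> toC B *m orbit_vec A b u k = 0.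
  case: k => -[] a; rewrite /orbit_vec /= ?andbF ?andbT.
    case: ifPn => [_ _|ba _]; first by rewrite mulmxA -toCM BA /toC map_mx0 mul0mx.
    by rewrite -conjv_toC BA0 ?conjv0 // Au.
  by move=> /Au /BA0.
rewrite mx_image_span; apply/span_subvP => _ /mapP [_ /mapP [k + ->] ->].
rewrite mem_enum inE => pk.
have [/andP [bk nk]|nbk] := boolP (b k.2 && ~~ k.1); last by rewrite Bt // mem0v.
have p0 : p <= 0 by move: pk; rewrite /deg (negPf nk) d0.
apply/mem_tflag => // l pl; rewrite sympQ_lie; last exact: sp_lie_toC.
rewrite Bt ?sympQ0r ?oppr0 //; apply/negP => /andP [bl nl].
by move: pl; rewrite /deg (negPf nl) d0 //; lia.
Qed.

Lemma exists_lift (h : {fsfun int -> nat with 0%N}) (S : {vspace 'cV[R]_(n + n)})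
    (s : set 'M[R]_(n + n)) F0 :
  hodge_numbers n h -> isotropic S -> (\dim S <= h 0)%N ->
  s `<=` closure (eta_plus S) -> nilpotent_orbit (siegel_numbers n) s F0 ->
  exists (l : nat) (N : 'I_l -> 'M[R]_(n + n)) b u d,
    [/\ polarized N, s = rcone N, orbit_frame (\sum_j N j) b u d,
        siegel_flag u = F0 &
        nilpotent_orbit h s (tflag (orbit_vec (\sum_j N j) b u) d)].
Proof.
move=> hh iS dS sS [cdF0 [l [Nq [nilq sE [c posF0]]]] _].
pose N j := ratR R (Nq j); have sN : s = rcone N by [].
have etaN j : Defs.eta S (N j) /\ psd (N j).
  by apply: closure_eta_plus; apply: sS; rewrite sN; exact: mem_rcone.
have pN : polarized N.
  split=> [j|j k]; first by case: (etaN j).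
  exact: eta_mul0 iS (proj1 (etaN j)) (proj1 (etaN k)).
set N0 := \sum_j N j.
have psd0 : psd N0 := rcone_psd pN (proj1 (relint_sum N)).
have N00 : N0 *m N0 = 0 by apply: (rcone_mul0 pN); exact: (proj1 (relint_sum N)).
pose Nx (x : 'I_l -> R) := \sum_j x j *: N j.
have psdx x : (forall j, 0 <= x j) -> psd (Nx x) by apply: psd_sum => j; case: (etaN j).
have Nxx x : Nx x *m Nx x = 0.
  rewrite mulmx_suml big1 // => j _; rewrite mulmx_sumr big1 // => k _.
  by rewrite -scalemxAl -scalemxAr (proj2 pN) !scaler0.
(* Above [c'] the coefficients are also positive, so [Nx x] is semidefinite. *)
pose c' := Num.max c 0.
have posL x v : (forall j, c' < x j) -> v \in F0 0 -> v != 0 -> 0 < polform (2 *: Nx x) v v.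
  move=> cx; apply: siegel_positive => //.
    apply: (proj1 (psdx x _)) => j; apply: ltW; apply: le_lt_trans (cx j).
    by rewrite le_max lexx orbT.
  by apply: posF0 => j; apply: le_lt_trans (cx j); rewrite le_max lexx.
have dL : \dim (F0 0) = n.
  by case: cdF0 => _ -> _; rewrite sum_siegel /= addn0.
have iL v w : v \in F0 0 -> w \in F0 0 -> sympQ v w = 0.
  by case: cdF0 => _ _ /(_ 0 v w); rewrite oppr0.
(* With all coefficients equal to [r], [Nx] is [r *: N0]; positivity at this one point suffices to
   build the frame. *)
pose r := c' + 1.
have [m [u [mn uL ft Au posu]]] : exists (m : nat) (u : 'I_n -> 'cV[C]_(n + n)),
    let b := [pred a : 'I_n | (m <= a)%N] in
    [/\ (m <= n)%N, forall a, u a \in F0 0, frame (orbit_vec N0 b u),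
        forall a, ~~ b a -> toC N0 *m u a = 0 &
        (forall a, ~~ b a -> 0 < 'i * sympQ (u a) (conjv (u a)))].
  apply: (@siegel_frame _ _ _ _ (2 * r)) => // v vL v0.
  have -> : (2 * r) *: N0 = 2 *: Nx (fun=> r).
    by rewrite /Nx -scaler_sumr scalerA.
  by apply: posL => // j; rewrite ltrDl.
(* The bound on [\dim S] enters here: there is room in degree 0 for all indices of [b]. *)
have mh : (n - m <= h 0)%N.
  apply: leq_trans dS; apply: (rank_bound ft) => v.
  rewrite mulmx_suml; apply: memv_suml => j _.
  by case: (etaN j) => -[_ ->].
have [d [ev d0 hd]] := degree_list hh mn mh.
set b := [pred a | _] in ft Au posu.
have ou : orbit_frame N0 b u d by split.
have spanu : F0 0 = <<map u (enum 'I_n)>>%VS.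
  apply/esym/eqP; rewrite eqEdim (dim_siegel ou) dL leqnn andbT.
  by apply/span_subvP => _ /mapP [a _ ->].
exists l, N, b, u, d; split=> //; first exact: siegel_dual_flag.
split; first exact: compact_dual_tflag.
  exists l, Nq; split=> //; exists c' => x cx.
  rewrite -[\sum_j _]/(Nx x).
  set M := 'i *: toC (Nx x).
  have cM : complex_span (rcone N) M.
    apply/complex_span_rcone; exists (fun j => 'i * real_complex R (x j)).
    rewrite /M /Nx toC_sum scaler_sumr; apply: eq_bigr => j _.
    by rewrite toCZ scalerA.
  (* The exponential moves the frame to another orbit frame for the same [N0]; its first half is
     positive by the Siegel condition at the same [x]. *)
  rewrite (expmx_nilp2 (cspan_mul0 pN cM cM)) filt_act_tflag (orbit_vec_exp pN cM Au).
  apply: period_domain_orbit_frame => //.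
  - exact: (proj1 psd0).
  - exact: (orbit_frame_exp pN cM ou).
  move=> v vL v0.
  have : v \in mx_image (1%:M + M) (F0 0) by rewrite spanu mx_image_span -map_comp.
  case/mem_mx_image => w wF ev'; rewrite ev'.
  have lx : sp_lie (Nx x).
    apply: (proj1 (psdx x _)) => j; apply: ltW; apply: le_lt_trans (cx j).
    by rewrite le_max lexx orbT.
  rewrite polform_exp //; apply: posL => //.
  by apply: contraNneq v0 => w0; rewrite ev' w0 mulmx0.
move=> B sB p; have [y y0 BE] : rcone N B by rewrite -sN.
apply: horizontal_tflag => //.
- by rewrite BE; exact: (proj1 (psdx y y0)).
- move=> v N0v; apply: (cspan_kernel pN _ N0v); apply/complex_span_rcone.
  exists (fun j => real_complex R (y j)); rewrite BE toC_sum.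
  by apply: eq_bigr => j _; rewrite toCZ.
- by apply: (rcone_mul0 pN); [rewrite -sN|exact: (proj1 (relint_sum N))].
Qed.

End LiftOrbit.

Theorem corollary2p8 (R : realType) (n : nat)
    (h : {fsfun int -> nat with 0%N}) (hh : hodge_numbers n h)
    (Gamma : set 'M[R]_(n + n)) (hGamma : arithmetic Gamma)
    (Sigma : {vspace 'cV[R]_(n + n)} -> set (set 'M[R]_(n + n)))
    (hSigma : admissible_family Gamma Sigma) :
  set_surj (quotient Gamma (extended_domain h (Sigma_ev h Sigma)))
           (quotient Gamma (extended_domain (siegel_numbers n) (Sigma_ev h Sigma)))
           (@pev_quotient R n).
Proof.
move=> _ [[s Z] [/= evs [F0 noF0 ->]] <-].
have [S [rS dS SS]] := evs; have [adm _ _] := hSigma.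
have [[_ /(_ s SS) sS] _ _ _] := adm S rS.
have [l [N [b [u [d [pN sN ou <- noF]]]]]] := exists_lift hh (proj1 rS) dS sS noF0.
pose y := (s, exp_orbit s (tflag (orbit_vec (\sum_j N j) b u) d)).
exists (orbit_of Gamma y).
  by exists y => //; split=> //; exists (tflag (orbit_vec (\sum_j N j) b u) d).
(* The two orbits are compared translate by translate, for each [g] in [Gamma]. *)
rewrite /pev_quotient /orbit_of image_comp; apply: eq_imagel => g Gg /=.
have hg : Sp g by case: hGamma => -[+ _ _ _] _ _; apply.
by rewrite /y sN (pev_point_act pN hg ou).
Qed.
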